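(* For every integer $n$ with $62 < n < 121$ and $n \notin \{64, 65, 67, 69, 73, 74\}$, there exists a 4-regular matchstick graph with exactly $n$ vertices.
   Context: A matchstick graph is a finite graph drawn in the Euclidean plane such that vertices are distinct points, every edge is a straight line segment of length 1 between its endpoints, and edges do not cross or overlap (two edges intersect at most in a common endpoint). A matchstick graph is 4-regular if every vertex has degree exactly 4. *)

(* Defs.v *)
From mathcomp Require Import all_boot.
From Stdlib Require Import Reals.

Set Implicit Arguments.
Unset Strict Implicit.
Unset Printing Implicit Defensive.

Definition point := (R * R)%type.

Definition sqdist (a b : point) : R :=
  ((fst a - fst b) * (fst a - fst b) + (snd a - snd b) * (snd a - snd b))%R.

Definition on_segment (a b q : point) : Prop :=
  exists t : R, (0 <= t <= 1)%R /\
    fst q = (fst a + t * (fst b - fst a))%R /\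
    snd q = (snd a + t * (snd b - snd a))%R.

Definition matchstick_graph (n : nat) (e : rel 'I_n) (p : 'I_n -> point) : Prop :=
  (forall i, ~~ e i i) /\
  (forall i j, e i j = e j i) /\
  injective p /\
  (forall i j, e i j -> sqdist (p i) (p j) = 1%R) /\
  (forall i j k l, e i j -> e k l ->
     [set i; j] != [set k; l] ->
     forall q : point, on_segment (p i) (p j) q -> on_segment (p k) (p l) q ->
       exists2 u, u \in [set i; j] :&: [set k; l] & q = p u).

Definition four_regular (n : nat) (e : rel 'I_n) : Prop :=
  forall i : 'I_n, #|[set j | e i j]| = 4.

(* Main.v *)
(** Call a piece a matchstick graph in which two vertices, the tips, have degree 2 and all
    others degree 4. Gluing at least three pieces cyclically at their tips, along the sides
    of a polygon, gives a 4-regular graph; the diagonals of the polygon can be chosen so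
    that the pieces do not collide. Pieces arise by reflecting a rigid half in a line through
    some of its vertices, and pieces with 22, 30, 31, 34, 35, 36 and 37 vertices give every
    order but 66, 68, 70 and 82. In these four cases a rigid quarter is reflected in two
    perpendicular lines.

    The halves and quarters have as many edges as free coordinates, so their exact
    realization is found near rational approximations by Newton's method: with [A] an
    approximate right inverse of the derivative of the edge equations [F] at [x], the map
    [y => y - F (x + A y)] is a contraction of a small cube. From there on, coordinates are
    known up to explicit errors. Unit edges with a common endpoint meet only there as soon
    as their other endpoints differ; disjoint edges are separated by linear functionals. *)

From Stdlib Require Import ZArith Lra Lia Psatz.
Require Import Defs.
From mathcomp Require Import all_boot.
From Stdlib Require Import Reals.

Set Implicit Arguments.
Unset Strict Implicit.
Unset Printing Implicit Defensive.

Delimit Scope nat_scope with N.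
Local Open Scope R_scope.

(** * Fixed-point ball arithmetic *)

Definition unitZ : Z := 1099511627776.
Notation U := (IZR unitZ).

Lemma U_gt0 : 0 < U. Proof. apply: IZR_lt. by []. Qed.

(* Midpoint and radius, in units of [2 ^ -40]. *)
Definition ball := (Z * Z)%type.

Definition in_ball (b : ball) (x : R) := Rabs (x * U - IZR b.1) <= IZR b.2.

Definition badd (a b : ball) : ball := (a.1 + b.1, a.2 + b.2)%Z.
Definition bopp (a : ball) : ball := (- a.1, a.2)%Z.
Definition bsub (a b : ball) : ball := badd a (bopp b).
(** In the product, the inverse and the root alike, the [+ 2] in the radius covers two roundings of
    at most one unit each: that of the midpoint and that of the radius itself. *)
Definition bmul (a b : ball) : ball :=
  (Z.shiftr (a.1 * b.1) 40,
   Z.shiftr (Z.abs a.1 * b.2 + Z.abs b.1 * a.2 + a.2 * b.2) 40 + 2)%Z.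
Definition binv (a : ball) : ball :=
  (unitZ * unitZ / a.1,
   unitZ * unitZ * a.2 / (Z.abs a.1 * (Z.abs a.1 - a.2)) + 2)%Z.
Definition bsqrt (a : ball) : ball :=
  let m := Z.sqrt (a.1 * unitZ) in (m, a.2 * unitZ / m + 2)%Z.

Definition nonzero (a : ball) := (a.2 <? Z.abs a.1)%Z.
Definition positive (a : ball) := (a.2 <? a.1)%Z.

Lemma in_ballP b x : in_ball b x <->
  exists d, [/\ x * U = IZR b.1 + d, - IZR b.2 <= d & d <= IZR b.2].
Proof.
rewrite /in_ball; split.
  move=> H; exists (x * U - IZR b.1); move: H; rewrite /Rabs; case: Rcase_abs => ? ?; split; lra.
case=> d [e h1 h2]; rewrite e; apply: Rabs_le; lra.
Qed.

Lemma in_badd a b x y : in_ball a x -> in_ball b y -> in_ball (badd a b) (x + y).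
Proof.
move=> /in_ballP[d [e1 h1 h2]] /in_ballP[d' [e2 h3 h4]].
apply/in_ballP; exists (d + d'); rewrite /= !plus_IZR; split; lra.
Qed.

Lemma in_bopp a x : in_ball a x -> in_ball (bopp a) (- x).
Proof.
move=> /in_ballP[d [e1 h1 h2]].
apply/in_ballP; exists (- d); rewrite /= !opp_IZR; split; lra.
Qed.

Lemma in_bsub a b x y : in_ball a x -> in_ball b y -> in_ball (bsub a b) (x - y).
Proof. by move=> ha hb; apply: in_badd => //; apply: in_bopp. Qed.

Lemma div_bounds (a b : Z) : (0 < b)%Z ->
  IZR a / IZR b - 1 < IZR (a / b) <= IZR a / IZR b.
Proof.
move=> b0; have B0 : 0 < IZR b by apply: IZR_lt.
have := Z.div_mod a b; have := Z.mod_pos_bound a b b0 => -[m0 m1] e.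
have {}e : IZR a = IZR b * IZR (a / b) + IZR (a mod b).
  by rewrite -mult_IZR -plus_IZR -e //; lia.
move/IZR_le: m0 => m0; move/IZR_lt: m1 => m1.
have -> : IZR a / IZR b = IZR (a / b) + IZR (a mod b) / IZR b by rewrite e; field; lra.
have : 0 <= IZR (a mod b) / IZR b < 1.
  split; first by apply: Rmult_le_pos => //; left; apply: Rinv_0_lt_compat.
  by apply: (Rmult_lt_reg_r (IZR b)) => //; rewrite /Rdiv Rmult_assoc Rinv_l; lra.
lra.
Qed.

Lemma in_bmul a b x y : in_ball a x -> in_ball b y -> in_ball (bmul a b) (x * y).
Proof.
rewrite /bmul !Z.shiftr_div_pow2 //; change (2 ^ 40)%Z with unitZ; move=> /in_ballP[d [e1 h1 h2]] /in_ballP[d' [e2 h3 h4]].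
have u0 := U_gt0.
have [l1 l2] := div_bounds (a.1 * b.1) (erefl : (0 < unitZ)%Z).
have [l3 l4] := div_bounds (Z.abs a.1 * b.2 + Z.abs b.1 * a.2 + a.2 * b.2) (erefl : (0 < unitZ)%Z).
set q := (a.1 * b.1 / unitZ)%Z in l1 l2; set r := ((_ + _ + _) / _)%Z in l3 l4.
rewrite /in_ball; change (Rabs (x * y * U - IZR q) <= IZR (r + 2)); rewrite plus_IZR.
(* The error is the propagated one plus the rounding of the midpoint. *)
have -> : x * y * U - IZR q = ((x * U) * (y * U) - IZR a.1 * IZR b.1) / U + (IZR (a.1 * b.1) / U - IZR q).
  by rewrite mult_IZR; field; lra.
apply: Rle_trans (Rabs_triang _ _) _.
have A1 : Rabs (IZR (a.1 * b.1) / U - IZR q) <= 1 by apply: Rabs_le; lra.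
have A2 : Rabs (((x * U) * (y * U) - IZR a.1 * IZR b.1) / U) <= IZR r + 1; last by lra.
apply: (Rle_trans _ (IZR (Z.abs a.1 * b.2 + Z.abs b.1 * a.2 + a.2 * b.2) / U)); last by lra.
rewrite /Rdiv Rabs_mult (Rabs_right (/ U)); last by left; apply: Rinv_0_lt_compat.
apply: Rmult_le_compat_r; first by left; apply: Rinv_0_lt_compat.
rewrite e1 e2 !plus_IZR !mult_IZR !abs_IZR.
have -> : (IZR a.1 + d) * (IZR b.1 + d') - IZR a.1 * IZR b.1 = IZR a.1 * d' + IZR b.1 * d + d * d' by ring.
have D : Rabs d <= IZR a.2 by apply: Rabs_le; lra.
have D' : Rabs d' <= IZR b.2 by apply: Rabs_le; lra.
have := Rabs_triang (IZR a.1 * d' + IZR b.1 * d) (d * d').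
have := Rabs_triang (IZR a.1 * d') (IZR b.1 * d).
rewrite !Rabs_mult.
have := Rmult_le_compat_l _ _ _ (Rabs_pos (IZR a.1)) D'.
have := Rmult_le_compat_l _ _ _ (Rabs_pos (IZR b.1)) D.
have := Rmult_le_compat _ _ _ _ (Rabs_pos d) (Rabs_pos d') D D'.
lra.
Qed.

(* Unification would otherwise unfold the shifts. *)
Opaque bmul.

Lemma nonzero_neq0 a x : nonzero a -> in_ball a x -> x <> 0.
Proof.
move=> /Z.ltb_spec0 /IZR_lt; rewrite abs_IZR => h /in_ballP[d [e h1 h2]] x0.
move: e; rewrite x0 Rmult_0_l => e.
have : IZR a.1 = - d by lra.
move=> e'; move: h; rewrite e' Rabs_Ropp; have : Rabs d <= IZR a.2 by apply: Rabs_le; lra.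
lra.
Qed.

Lemma positive_gt0 a x : positive a -> in_ball a x -> 0 < x.
Proof.
move=> /Z.ltb_spec0 /IZR_lt h /in_ballP[d [e h1 h2]].
have u0 := U_gt0.
have : 0 < x * U by lra.
by move=> h0; apply: (Rmult_lt_reg_r U) => //; lra.
Qed.

Lemma div_bounds_abs (a b : Z) : (b <> 0)%Z -> Rabs (IZR a / IZR b - IZR (a / b)) <= 1.
Proof.
move=> b0; case: (Z_lt_le_dec 0 b) => hb.
  have := div_bounds a hb => h; apply: Rabs_le; lra.
have hb' : (0 < - b)%Z by lia.
have := div_bounds (- a) hb'; rewrite Z.div_opp_opp // !opp_IZR.
have -> : - IZR a / - IZR b = IZR a / IZR b by field; apply: not_0_IZR.
by move=> h; apply: Rabs_le; lra.
Qed.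

(** Write [X = x * U], and [a], [r] for midpoint and radius. The error before rounding is
    [U^2 |X - a| / (|a| |X|)], and [|X| >= |a| - r]. *)
Lemma in_binv a x : nonzero a -> in_ball a x -> in_ball (binv a) (/ x).
Proof.
move=> nz h; have x0 := nonzero_neq0 nz h.
move: nz => /Z.ltb_spec0 nz; move: h; rewrite /in_ball => h.
have r0 : 0 <= IZR a.2 by apply: Rle_trans h; apply: Rabs_pos.
have u0 := U_gt0; move/le_IZR: (r0) => r0z.
have a0 : (a.1 <> 0)%Z by lia.
have A0 : IZR a.1 <> 0 by apply: not_0_IZR.
have pz : (0 < Z.abs a.1 * (Z.abs a.1 - a.2))%Z by nia.
have l1 := div_bounds_abs (unitZ * unitZ) a0.
have [l3 l4] := div_bounds (unitZ * unitZ * a.2) pz.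
set q := (unitZ * unitZ / a.1)%Z in l1; set r := (_ / (_ * _))%Z in l3 l4.
change (Rabs (/ x * U - IZR q) <= IZR (r + 2)); rewrite plus_IZR.
have -> : / x * U - IZR q = (/ x * U - IZR (unitZ * unitZ) / IZR a.1) + (IZR (unitZ * unitZ) / IZR a.1 - IZR q) by ring.
apply: Rle_trans (Rabs_triang _ _) _.
suff A2 : Rabs (/ x * U - IZR (unitZ * unitZ) / IZR a.1) <= IZR r + 1 by lra.
apply: (Rle_trans _ (IZR (unitZ * unitZ * a.2) / IZR (Z.abs a.1 * (Z.abs a.1 - a.2)))); last by lra.
rewrite !mult_IZR.
have -> : / x * U - U * U / IZR a.1 = (- (x * U - IZR a.1)) * (U * U * / (IZR a.1 * (x * U))) by field; repeat split => //; lra.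
have -> : U * U * IZR a.2 / (IZR (Z.abs a.1) * IZR (Z.abs a.1 - a.2)) = IZR a.2 * (U * U * / (IZR (Z.abs a.1) * IZR (Z.abs a.1 - a.2))) by rewrite /Rdiv; ring.
have q0 : 0 < IZR (Z.abs a.1) by apply: IZR_lt; lia.
have q1 : 0 < IZR (Z.abs a.1 - a.2) by apply: IZR_lt; lia.
rewrite Rabs_mult Rabs_Ropp; apply: Rmult_le_compat => //; try exact: Rabs_pos.
rewrite Rabs_mult (Rabs_right (U * U)); last by nra.
apply: Rmult_le_compat_l; first by nra.
rewrite Rabs_inv; apply: Rinv_le_contravar; first by nra.
rewrite Rabs_mult -abs_IZR; apply: Rmult_le_compat_l; first by lra.
rewrite minus_IZR abs_IZR.
have := Rabs_triang_inv (IZR a.1) (IZR a.1 - x * U).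
have -> : IZR a.1 - (IZR a.1 - x * U) = x * U by ring.
rewrite Rabs_minus_sym in h; lra.
Qed.

(** Compare [y = sqrt x * U] with the root [t] of the scaled midpoint: [(y - t) (y + t)] is [U]
    times the error of the argument, and [y + t] is at least the rounded root [m]. *)
Lemma in_bsqrt a x : positive a -> in_ball a x -> in_ball (bsqrt a) (sqrt x).
Proof.
move=> ps h; have x0 := positive_gt0 ps h.
move: ps => /Z.ltb_spec0 ps; move: h; rewrite /in_ball => h.
have r0 : 0 <= IZR a.2 by apply: Rle_trans h; apply: Rabs_pos.
have u0 := U_gt0; move/le_IZR: (r0) => r0z.
have a0 : (0 < a.1)%Z by lia.
have aU : (1 <= a.1 * unitZ)%Z by rewrite /unitZ; lia.
have [s1 s2] : (Z.sqrt (a.1 * unitZ) * Z.sqrt (a.1 * unitZ) <= a.1 * unitZ < Z.succ (Z.sqrt (a.1 * unitZ)) * Z.succ (Z.sqrt (a.1 * unitZ)))%Z by apply: Z.sqrt_spec; lia.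
have m0 : (1 <= Z.sqrt (a.1 * unitZ))%Z by apply: (Z.sqrt_le_mono 1).
rewrite /bsqrt /=; set m := Z.sqrt _ in s1 s2 m0 *.
have M0 : 0 < IZR m by apply: IZR_lt; lia.
have [l1 l2] := div_bounds (a.2 * unitZ) (ltac:(lia) : (0 < m)%Z).
set r := (a.2 * unitZ / m)%Z in l1 l2 *.
rewrite plus_IZR.
set t := sqrt (IZR a.1 * U).
have t0 : 0 <= t by apply: sqrt_pos.
have A0 : 0 < IZR a.1 by apply: IZR_lt.
have tt : t * t = IZR a.1 * U by apply: sqrt_sqrt; nra.
have mt : IZR m <= t < IZR m + 1.
  move/IZR_le: s1; move/IZR_lt: s2; rewrite !mult_IZR succ_IZR -tt => h1 h2.
  split; nra.
set y := sqrt x * U.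
have y0 : 0 <= y by apply: Rmult_le_pos; [apply: sqrt_pos | lra].
have yy : y * y = x * U * U.
  by rewrite /y -{3}(sqrt_sqrt x); [ring | lra].
have key : Rabs (y - t) <= IZR r + 1.
  apply: (Rle_trans _ (IZR (a.2 * unitZ) / IZR m)); last by lra.
  rewrite mult_IZR; apply: (Rmult_le_reg_r (IZR m)) => //.
  have -> : IZR a.2 * U / IZR m * IZR m = IZR a.2 * U by field; lra.
  apply: (Rle_trans _ (Rabs (y - t) * (y + t))).
    by apply: Rmult_le_compat_l; [apply: Rabs_pos | lra].
  rewrite -{1}(Rabs_right (y + t)); last by lra.
  rewrite -Rabs_mult.
  have -> : (y - t) * (y + t) = (x * U - IZR a.1) * U by nra.
  rewrite Rabs_mult (Rabs_right U); last by lra.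
  by apply: Rmult_le_compat_r; lra.
have -> : y - IZR m = (y - t) + (t - IZR m) by ring.
 apply: Rle_trans (Rabs_triang _ _) _.
have : Rabs (t - IZR m) <= 1 by apply: Rabs_le; lra.
lra.
Qed.

(** * Approximate points, figures and gluing *)

Definition bpoint := (ball * ball)%type.
Definition b0 : ball := (0, 0)%Z.
Definition bp0 : bpoint := (b0, b0).
Definition p0 : point := (0, 0).

Definition near (b : bpoint) (p : point) := in_ball b.1 p.1 /\ in_ball b.2 p.2.

Lemma in_b0 x : in_ball b0 x <-> x = 0.
Proof.
have u0 := U_gt0; split=> [/in_ballP[d [e h1 h2]]|->]; last first.
  by rewrite /in_ball /= Rmult_0_l Rminus_diag Rabs_R0; lra.
have {}e : x * U = 0 by move: e h1 h2 => /=; lra.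
by case: (Rmult_integral _ _ e) => //; lra.
Qed.

(** Only a ball of radius zero can certify that a vertex lies exactly on a mirror line. *)
Definition exact0 (b : ball) := ((b.1 =? 0) && (b.2 =? 0))%Z.

Lemma exact0_eq b x : exact0 b -> in_ball b x -> x = 0.
Proof.
by case: b => m r /andP[/Z.eqb_spec e1 /Z.eqb_spec e2]; move: e1 e2 => /= -> -> /in_b0.
Qed.

Lemma sqdistC p q : sqdist p q = sqdist q p.
Proof. by rewrite /sqdist; ring. Qed.

(** A figure is finite data; the exact coordinates are never written down. [realizable] says that
    some points inside the balls satisfy all edge equations exactly. *)
Record fig := Fig { fpts : seq bpoint; fedges : seq (nat * nat) }.

Definition fnth (F : fig) i := nth bp0 (fpts F) i.

Definition realizes (ps : seq point) (F : fig) :=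
  [/\ size ps = size (fpts F),
      forall i, (i < size ps)%N -> near (fnth F i) (nth p0 ps i) &
      forall e, e \in fedges F ->
        [/\ (e.1 < size ps)%N, (e.2 < size ps)%N &
            sqdist (nth p0 ps e.1) (nth p0 ps e.2) = 1]].

Definition realizable F := exists ps, realizes ps F.

Section Glue.
Variables (T : Type) (d : T).
Definition others n (ks : seq nat) := [seq i <- iota 0 n | i \notin ks].
Definition glue (X Y : seq T) (g : T -> T) ks :=
  X ++ [seq g (nth d Y i) | i <- others (size Y) ks].
End Glue.

(** A pair [(k, v)] in [s] identifies vertex [k] of the second figure with vertex [v] of the first;
    every other vertex gets its place in the part appended by [glue]. *)
Definition reindex nX nY (s : seq (nat * nat)) i :=
  if i \in unzip1 s then nth 0%N (unzip2 s) (index i (unzip1 s))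
  else (nX + index i (others nY (unzip1 s)))%N.

Lemma mem_others n ks i : (i \in others n ks) = (i < n)%N && (i \notin ks).
Proof. by rewrite mem_filter mem_iota add0n andbC. Qed.

Lemma nth_reindex T (d : T) (X Y : seq T) g s i :
  (i < size Y)%N ->
  (forall k v, (k, v) \in s -> (v < size X)%N /\ g (nth d Y k) = nth d X v) ->
  (reindex (size X) (size Y) s i < size (glue d X Y g (unzip1 s)))%N /\
  nth d (glue d X Y g (unzip1 s)) (reindex (size X) (size Y) s i) = g (nth d Y i).
Proof.
move=> iY hs; rewrite /reindex /glue; case: ifP => ks.
  have js : (index i (unzip1 s) < size s)%N by rewrite -(size_map fst) index_mem.
  have := mem_nth (0, 0)%N js; set j := index i _ in js *.
  have e1 : (nth (0, 0)%N s j).1 = i by rewrite -(nth_map _ 0%N) // nth_index.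
  have e2 : (nth (0, 0)%N s j).2 = nth 0%N (unzip2 s) j by rewrite -(nth_map _ 0%N).
  rewrite [X in X \in s]surjective_pairing e1 e2 => /hs [vX e].
  by rewrite size_cat ltn_addr // nth_cat vX.
have io : i \in others (size Y) (unzip1 s) by rewrite mem_others iY ks.
rewrite size_cat size_map ltn_add2l index_mem io nth_cat ltnNge leq_addr /= addKn; split=> //.
by rewrite (nth_map 0%N) ?index_mem // nth_index.
Qed.

Definition joinF (F G : fig) (g : bpoint -> bpoint) (s : seq (nat * nat)) :=
  Fig (glue bp0 (fpts F) (fpts G) g (unzip1 s))
      (fedges F ++ [seq (reindex (size (fpts F)) (size (fpts G)) s e.1,
                         reindex (size (fpts F)) (size (fpts G)) s e.2) | e <- fedges G]).

Lemma joinF_realizes ps qs F G gB gR s :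
  realizes ps F -> realizes qs G ->
  (forall b p, near b p -> near (gB b) (gR p)) ->
  (forall p q, sqdist (gR p) (gR q) = sqdist p q) ->
  (forall k v, (k, v) \in s -> (v < size ps)%N /\ gR (nth p0 qs k) = nth p0 ps v) ->
  realizes (glue p0 ps qs gR (unzip1 s)) (joinF F G gB s).
Proof.
move=> [sF nF eF] [sG nG eG] gBR iso hs.
split.
- by rewrite /joinF /glue /= !size_cat !size_map sF sG.
- move=> i; rewrite /fnth /joinF /= /glue !nth_cat size_cat size_map -sF => ilt.
  case: ltnP => hi; first exact: nF.
  have ilt' : (i - size ps < size (others (size qs) (unzip1 s)))%N by rewrite ltn_subLR.
  rewrite -sG !(nth_map 0%N) //; apply: gBR; apply: nG.
  have := mem_nth 0%N ilt'.
  by rewrite mem_others => /andP[].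
- move=> e; rewrite /joinF /= mem_cat => /orP[/eF [h1 h2 h3]|/mapP[e' /eG [h1 h2 h3] ->]].
    by rewrite /glue !nth_cat h1 h2 size_cat !ltn_addr.
  rewrite -sF -sG /=.
  have [l1 ->] := nth_reindex h1 hs; have [l2 ->] := nth_reindex h2 hs.
  by split=> //; rewrite iso.
Qed.

(** * Reflections in the coordinate axes *)

Definition conjp (p : point) : point := (p.1, - p.2).
Definition bconj (b : bpoint) : bpoint := (b.1, bopp b.2).
Definition revp (p : point) : point := (- p.1, p.2).
Definition brev (b : bpoint) : bpoint := (bopp b.1, b.2).

(** Vertices on the mirror line are their own images and must not be duplicated. *)
Definition diag (ks : seq nat) := [seq (k, k) | k <- ks].

Definition mirrorX (F : fig) ks := joinF F F bconj (diag ks).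
Definition mirrorY (F : fig) ks := joinF F F brev (diag ks).
Definition mirrorX_ok (F : fig) ks :=
  all (fun k => (k < size (fpts F))%N && exact0 (fnth F k).2) ks.
Definition mirrorY_ok (F : fig) ks :=
  all (fun k => (k < size (fpts F))%N && exact0 (fnth F k).1) ks.

Lemma in_diag k v ks : (k, v) \in diag ks -> k \in ks /\ v = k.
Proof. by move=> /mapP[j jk [-> ->]]. Qed.

Lemma mirrorX_realizable F ks : mirrorX_ok F ks -> realizable F -> realizable (mirrorX F ks).
Proof.
move=> ok [ps h]; exists (glue p0 ps ps conjp (unzip1 (diag ks))).
apply: joinF_realizes => //.
- by move=> b p [h1 h2]; split=> //; apply: in_bopp.
- by move=> p q; rewrite /sqdist /=; ring.
- move=> k v /in_diag[kk ->]; have /andP[l e] := allP ok _ kk.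
  case: h => sF nF _; rewrite sF; split=> //; move: (nF k); rewrite sF => /(_ l)[_] /(exact0_eq e); case: (nth _ _ _) => x y /= ->.
  by rewrite /conjp /= Ropp_0.
Qed.

Lemma mirrorY_realizable F ks : mirrorY_ok F ks -> realizable F -> realizable (mirrorY F ks).
Proof.
move=> ok [ps h]; exists (glue p0 ps ps revp (unzip1 (diag ks))).
apply: joinF_realizes => //.
- by move=> b p [h1 h2]; split=> //; apply: in_bopp.
- by move=> p q; rewrite /sqdist /=; ring.
- move=> k v /in_diag[kk ->]; have /andP[l e] := allP ok _ kk.
  case: h => sF nF _; rewrite sF; split=> //; move: (nF k); rewrite sF => /(_ l)[] /(exact0_eq e); case: (nth _ _ _) => x y /= -> _.
  by rewrite /revp /= Ropp_0.
Qed.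

(** * Complex arithmetic, similarities and triangles *)

Definition cadd (p q : point) : point := (p.1 + q.1, p.2 + q.2).
Definition csub (p q : point) : point := (p.1 - q.1, p.2 - q.2).
Definition cmul (p q : point) : point :=
  (p.1 * q.1 - p.2 * q.2, p.1 * q.2 + p.2 * q.1).
Definition bcadd (p q : bpoint) : bpoint := (badd p.1 q.1, badd p.2 q.2).
Definition bcsub (p q : bpoint) : bpoint := (bsub p.1 q.1, bsub p.2 q.2).
Definition bcmul (p q : bpoint) : bpoint :=
  (bsub (bmul p.1 q.1) (bmul p.2 q.2), badd (bmul p.1 q.2) (bmul p.2 q.1)).
Definition bsqdist (p q : bpoint) : ball :=
  badd (bmul (bsub p.1 q.1) (bsub p.1 q.1)) (bmul (bsub p.2 q.2) (bsub p.2 q.2)).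

Lemma near_cadd a b p q : near a p -> near b q -> near (bcadd a b) (cadd p q).
Proof. by case=> ? ? [? ?]; split; apply: in_badd. Qed.
Lemma near_csub a b p q : near a p -> near b q -> near (bcsub a b) (csub p q).
Proof. by case=> ? ? [? ?]; split; apply: in_bsub. Qed.
Lemma near_cmul a b p q : near a p -> near b q -> near (bcmul a b) (cmul p q).
Proof.
by case=> ? ? [? ?]; split; [apply: in_bsub | apply: in_badd]; apply: in_bmul.
Qed.
Lemma in_bsqdist a b p q : near a p -> near b q -> in_ball (bsqdist a b) (sqdist p q).
Proof. by case=> ? ? [? ?]; apply: in_badd; apply: in_bmul; apply: in_bsub. Qed.

(* The direct similarity sending [t0] to [a] and [t1] to [b]. *)
Definition rot (a b t0 t1 : point) : point :=
  let i := / sqdist t1 t0 in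
  let w := cmul (csub b a) (conjp (csub t1 t0)) in (w.1 * i, w.2 * i).
Definition place a b t0 t1 z : point := cadd a (cmul (rot a b t0 t1) (csub z t0)).
Definition brot (a b t0 t1 : bpoint) : bpoint :=
  let i := binv (bsqdist t1 t0) in
  let w := bcmul (bcsub b a) (bconj (bcsub t1 t0)) in (bmul w.1 i, bmul w.2 i).
Definition bplace (a b t0 t1 : bpoint) :=
  let r := brot a b t0 t1 in fun z => bcadd a (bcmul r (bcsub z t0)).

Lemma near_place A B T0 T1 Z a b t0 t1 z :
  nonzero (bsqdist T1 T0) ->
  near A a -> near B b -> near T0 t0 -> near T1 t1 -> near Z z ->
  near (bplace A B T0 T1 Z) (place a b t0 t1 z).
Proof.
move=> nz hA hB h0 h1 hZ; apply: near_cadd => //; apply: near_cmul; last exact: near_csub.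
have hi := in_binv nz (in_bsqdist h1 h0).
have [] : near (bcmul (bcsub B A) (bconj (bcsub T1 T0))) (cmul (csub b a) (conjp (csub t1 t0))).
  apply: near_cmul; first exact: near_csub.
  by case: (near_csub h1 h0) => h2 h3; split=> //; apply: in_bopp.
by move=> ? ?; split; apply: in_bmul.
Qed.

(** A direct similarity multiplies squared distances by the ratio [sqdist b a / sqdist t1 t0], which
    is one here. *)
Lemma place_iso a b t0 t1 p q : sqdist t1 t0 <> 0 -> sqdist b a = sqdist t1 t0 ->
  sqdist (place a b t0 t1 p) (place a b t0 t1 q) = sqdist p q.
Proof.
move=> n0 e.
have -> : sqdist (place a b t0 t1 p) (place a b t0 t1 q) =
   (sqdist b a * sqdist t1 t0 * (/ sqdist t1 t0 * / sqdist t1 t0)) * sqdist p q.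
  rewrite /place /rot; set i := / _.
  by rewrite /sqdist /cadd /cmul /csub /conjp /=; ring.
by rewrite e; field.
Qed.

Lemma place0 a b t0 t1 : place a b t0 t1 t0 = a.
Proof.
rewrite /place /rot /cadd /cmul /csub /=; case: a => x y /=; congr (_, _); ring.
Qed.

Lemma place1 a b t0 t1 : sqdist t1 t0 <> 0 -> place a b t0 t1 t1 = b.
Proof.
rewrite /place /rot => n0.
have h : / sqdist t1 t0 * sqdist t1 t0 = 1 by field.
move: h; set i := / _; rewrite /sqdist /cadd /cmul /csub /conjp.
case: a b t0 t1 {n0 i} (i) => ax ay [bx by_] [x0 y0] [x1 y1] i /= h.
congr (_, _).
- transitivity (ax + (bx - ax) * (i * ((x1 - x0) * (x1 - x0) + (y1 - y0) * (y1 - y0)))); first by ring.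
  by rewrite h; ring.
- transitivity (ay + (by_ - ay) * (i * ((x1 - x0) * (x1 - x0) + (y1 - y0) * (y1 - y0)))); first by ring.
  by rewrite h; ring.
Qed.

(* The point at distances [sqrt d] from the origin and [sqrt l] from [v]. *)
Definition apex (v : point) (d l : R) : point :=
  let n := sqdist v p0 in
  let s := (n + d - l) * / (n + n) in
  cmul v (s, sqrt (d * / n - s * s)).
(** In the frame with unit vector [v], the apex is [(s, h)], where [s] comes from the law of
    cosines. The second component is [h^2], left without its root so that its positivity, which
    excludes degenerate triangles, can be tested. *)
Definition bapex_parts (v : bpoint) (d l : ball) :=
  let n := bsqdist v bp0 in
  let s := bmul (bsub (badd n d) l) (binv (badd n n)) in
  (s, bsub (bmul d (binv n)) (bmul s s)).
Definition bapex (v : bpoint) (d l : ball) : bpoint :=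
  let sh := bapex_parts v d l in bcmul v (sh.1, bsqrt sh.2).
Definition apex_ok (v : bpoint) (d l : ball) :=
  let n := bsqdist v bp0 in
  [&& nonzero n, nonzero (badd n n) & positive (bapex_parts v d l).2].

Lemma near_p0 : near bp0 p0.
Proof. by split; apply/in_b0. Qed.

Lemma apexP V D L v d l : apex_ok V D L -> near V v -> in_ball D d -> in_ball L l ->
  [/\ near (bapex V D L) (apex v d l), sqdist (apex v d l) p0 = d &
      sqdist (apex v d l) v = l].
Proof.
case/and3P=> n1 n2 ps hV hD hL.
have hn := in_bsqdist hV near_p0.
have nz := nonzero_neq0 n1 hn.
have hs : in_ball (bapex_parts V D L).1 ((sqdist v p0 + d - l) * / (sqdist v p0 + sqdist v p0)).
  apply: in_bmul; first by apply: in_bsub => //; apply: in_badd.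
  by apply: in_binv => //; apply: in_badd.
have hh : in_ball (bapex_parts V D L).2 (d * / sqdist v p0 - (sqdist v p0 + d - l) * / (sqdist v p0 + sqdist v p0) * ((sqdist v p0 + d - l) * / (sqdist v p0 + sqdist v p0))).
  by apply: in_bsub; apply: in_bmul => //; apply: in_binv.
have pos := positive_gt0 ps hh.
have {}hh := in_bsqrt ps hh.
split.
  rewrite /bapex; case: (bapex_parts V D L) hs hh => sB hB /= hs hh.
  by apply: near_cmul; last split.
all: rewrite /apex; set n := sqdist v p0 in nz pos *; set s := (n + d - l) * _ in pos *.
all: set h := sqrt _; have h2 : h * h = d * / n - s * s by apply: sqrt_sqrt; lra.
all: have es : s = (n + d - l) / (n + n) by [].
  transitivity (n * (s * s + h * h)); first by rewrite /n /sqdist /cmul /p0 /=; ring.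
  by rewrite h2; field.
transitivity (n * (s * s + h * h) + n * (1 - 2 * s)); first by rewrite /n /sqdist /cmul /p0 /=; ring.
by rewrite h2 es; field; repeat split => //; lra.
Qed.

(** * Polygons with prescribed sides *)

(** The polygon is triangulated from the origin: each vertex is the apex over its predecessor, given
    the next squared side and the next squared diagonal. The positive root makes the fan turn
    counterclockwise. *)
Fixpoint fan (v : point) (ls ds : seq R) : seq point :=
  if ls is l :: ls' then let w := apex v (head 0 ds) l in w :: fan w ls' (behead ds)
  else [::].
Fixpoint bfan (v : bpoint) (ls ds : seq ball) : seq bpoint :=
  if ls is l :: ls' then let w := bapex v (head b0 ds) l in w :: bfan w ls' (behead ds)
  else [::].
Fixpoint fan_ok (v : bpoint) (ls ds : seq ball) :=
  if ls is l :: ls' then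
    apex_ok v (head b0 ds) l && fan_ok (bapex v (head b0 ds) l) ls' (behead ds)
  else true.

Fixpoint in_balls (bs : seq ball) (xs : seq R) : Prop :=
  match bs, xs with
  | [::], [::] => True
  | b :: bs', x :: xs' => in_ball b x /\ in_balls bs' xs'
  | _, _ => False
  end.

(** The index [0] after the last side closes the polygon. *)
Fixpoint chain (ps : seq point) i (ls : seq R) : Prop :=
  if ls is l :: ls' then
    sqdist (nth p0 ps (if ls' is [::] then 0%N else i.+1)) (nth p0 ps i) = l /\
    chain ps i.+1 ls'
  else True.

(** [pre] carries the vertices already placed through the induction. The last diagonal leads back to
    the origin, so it serves as the closing side of the chain. *)
Lemma fanP V v L l D d : fan_ok V L D -> near V v -> in_balls L l -> in_balls D d ->
  size l = size d ->
  (forall i, (i < size l)%N -> near (nth bp0 (bfan V L D) i) (nth p0 (fan v l d) i)) /\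
  forall pre, nth p0 (pre ++ v :: fan v l d) 0 = p0 ->
    chain (pre ++ v :: fan v l d) (size pre) (rcons l (last (sqdist v p0) d)).
Proof.
elim: L V v l D d => [|a L IH] V v [|b l] //= D [|d0 d] //.
- move=> _ _ _ _ _; split=> // pre -> /=.
  by rewrite nth_cat ltnn subnn /= sqdistC.
- case: D => // D0 D /= /andP[ok1 ok2] hV [hb hl] [hd0 hd] [sz].
  have [h1 h2 h3] := apexP ok1 hV hd0 hb.
  have [n c] := IH _ _ _ _ _ ok2 h1 hl hd sz.
  split; first by case.
  move=> pre hpre; split.
    have -> : (if rcons l (last d0 d) is [::] then 0%N else (size pre).+1) = (size pre).+1 by case: (l).
    by rewrite !nth_cat ltnn subnn ltnNge leqnSn /= subSnn /= h3.
  have := c (rcons pre v); rewrite size_rcons cat_rcons h2; exact.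
Qed.

Lemma size_fan v l d : size (fan v l d) = size l.
Proof. by elim: l v d => //= a l IH v d; rewrite IH. Qed.
Lemma size_bfan v l d : size (bfan v l d) = size l.
Proof. by elim: l v d => //= a l IH v d; rewrite IH. Qed.
Lemma in_balls_size bs xs : in_balls bs xs -> size bs = size xs.
Proof. by elim: bs xs => [|b bs IH] [|x xs] //= [_ /IH ->]. Qed.

(** * Rings of pieces along the sides of a polygon *)

(* A piece with its two tips, in the order in which the ring runs through them. *)
Definition link := (fig * nat * nat)%type.

Definition link_len (y : link) : ball := bsqdist (fnth y.1.1 y.2) (fnth y.1.1 y.1.2).
Definition link_ok (y : link) :=
  [&& (y.1.2 < size (fpts y.1.1))%N, (y.2 < size (fpts y.1.1))%N & nonzero (link_len y)].

Fixpoint attach (F : fig) i (ys : seq link) : fig :=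
  if ys is y :: ys' then
    let j := if ys' is [::] then 0%N else i.+1 in
    attach (joinF F y.1.1 (bplace (fnth F i) (fnth F j) (fnth y.1.1 y.1.2) (fnth y.1.1 y.2))
              [:: (y.1.2, i); (y.2, j)]) i.+1 ys'
  else F.

Definition has_len (y : link) (l : R) :=
  exists2 qs, realizes qs y.1.1 & sqdist (nth p0 qs y.2) (nth p0 qs y.1.2) = l.

Fixpoint have_lens (ys : seq link) (ls : seq R) : Prop :=
  match ys, ls with
  | [::], [::] => True
  | y :: ys', l :: ls' => has_len y l /\ have_lens ys' ls'
  | _, _ => False
  end.

(** Gluing only appends vertices, so the polygon stays in front with its numbering while the links
    are attached one by one. *)
Lemma chain_prefix ps ps' i ls : (0 < size ps)%N -> (i + size ls <= size ps)%N ->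
  (forall k, (k < size ps)%N -> nth p0 ps' k = nth p0 ps k) -> chain ps i ls -> chain ps' i ls.
Proof.
move=> s0 + pre; elim: ls i => //= l ls IH i; rewrite addnS => ilt [<- c]; split.
  rewrite !pre //; first by apply: leq_trans ilt; rewrite ltnS leq_addr.
  by case: (ls) ilt => //= l' ls'; rewrite addnS => ilt; apply: leq_trans ilt; rewrite !ltnS leq_addr.
by apply: IH => //; rewrite addSn.
Qed.

(** Each side of the polygon is exactly as long as the tip distance of its link, so the similarity
    that carries the tips to the ends of the side is an isometry. *)
Lemma attach_realizable ys F i ps ls :
  all link_ok ys -> realizes ps F -> have_lens ys ls -> chain ps i ls ->
  (0 < size ps)%N -> (i + size ys <= size ps)%N ->
  realizable (attach F i ys).
Proof.
elim: ys F i ps ls => [|y ys IH] F i ps [|l ls] //=; first by move=> _ h; exists ps.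
case/andP=> /and3P[t0 t1 nz] oks hF [[qs hq hl] hls] [c0 c] s0.
rewrite addnS => isz.
have szl : size ys = size ls.
  by elim: (ys) (ls) hls => [|? ? IH'] [|? ?] //= [_ /IH' ->].
set j := (if ys is [::] then 0%N else i.+1).
have jE : (if ls is [::] then 0%N else i.+1) = j by rewrite /j; case: (ys) (ls) szl => [|? ?] [|? ?].
rewrite jE in c0.
have ip : (i < size ps)%N by apply: leq_trans isz; rewrite ltnS leq_addr.
have jp : (j < size ps)%N.
  by rewrite /j; case: (ys) isz => //= ? ?; rewrite addnS => isz; apply: leq_trans isz; rewrite !ltnS leq_addr.
have [sq nq eq] := hq; have [sF nF eF] := hF.
have n0 : near (fnth y.1.1 y.1.2) (nth p0 qs y.1.2) by apply: nq; rewrite sq.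
have n1 : near (fnth y.1.1 y.2) (nth p0 qs y.2) by apply: nq; rewrite sq.
have l0 := nonzero_neq0 nz (in_bsqdist n1 n0).
set gR := place (nth p0 ps i) (nth p0 ps j) (nth p0 qs y.1.2) (nth p0 qs y.2).
have J : realizes (glue p0 ps qs gR (unzip1 [:: (y.1.2, i); (y.2, j)]))
  (joinF F y.1.1 (bplace (fnth F i) (fnth F j) (fnth y.1.1 y.1.2) (fnth y.1.1 y.2)) [:: (y.1.2, i); (y.2, j)]).
  apply: joinF_realizes => //.
  - by move=> b p hb; apply: near_place => //; apply: nF.
  - by move=> p q; apply: place_iso => //; rewrite c0 hl.
  - move=> k v; rewrite !inE => /orP[] /eqP[-> ->]; split=> //.
      exact: place0.
    exact: place1.
have sub k : (k < size ps)%N -> nth p0 (glue p0 ps qs gR (unzip1 [:: (y.1.2, i); (y.2, j)])) k = nth p0 ps k.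
  by move=> kp; rewrite /glue nth_cat kp.
have szg : (size ps <= size (glue p0 ps qs gR (unzip1 [:: (y.1.2, i); (y.2, j)])))%N.
  by rewrite /glue size_cat leq_addr.
apply: (IH _ _ _ ls oks J hls).
- by apply: chain_prefix sub c => //; rewrite -szl addSn.
- exact: leq_trans szg.
- by apply: leq_trans szg; rewrite addSn.
Qed.

(* The vertices of a polygon with squared sides [l0 :: l1 :: ls] (the last side
   being [last ds]), fanned out from the origin along diagonals with squares [ds]. *)
Definition polygon (l0 : ball) (ls ds : seq ball) : seq bpoint :=
  let v := (bsqrt l0, b0) in bp0 :: v :: bfan v ls ds.

(* Consecutive links share end points; [ds] are the lengths of the diagonals. *)
Definition ring (ys : seq link) (ds : seq Z) : fig :=
  let ls := map link_len ys in
  let m := (size ys).-2 in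
  attach (Fig (polygon (head b0 ls) (take m (behead ls))
                 (rcons [seq bmul (d, 0%Z) (d, 0%Z) | d <- ds] (last b0 ls))) [::]) 0 ys.
(** Of [k] sides, the first is laid on the axis and the last closes the polygon. This leaves [k - 2]
    vertices to construct and [k - 3] diagonals to choose. *)
Definition ring_ok (ys : seq link) (ds : seq Z) :=
  let ls := map link_len ys in
  let m := (size ys).-2 in
  [&& (1 < size ys)%N, size ds == m.-1, (0 < m)%N, all link_ok ys, positive (head b0 ls) &
    fan_ok (bsqrt (head b0 ls), b0) (take m (behead ls))
                 (rcons [seq bmul (d, 0%Z) (d, 0%Z) | d <- ds] (last b0 ls))].

Lemma in_balls_cat bs cs xs ys : in_balls bs xs -> in_balls cs ys -> in_balls (bs ++ cs) (xs ++ ys).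
Proof. by elim: bs xs => [|b bs IH] [|x xs] //= [h1 h2] h3; split=> //; apply: IH. Qed.

Lemma in_ball_const z : in_ball (z, 0%Z) (IZR z / U).
Proof.
have u0 := U_gt0; rewrite /in_ball /=.
have -> : IZR z / U * U - IZR z = 0 by field; lra.
by rewrite Rabs_R0; apply: Rle_refl.
Qed.

Lemma in_balls_take n bs xs : in_balls bs xs -> in_balls (take n bs) (take n xs).
Proof. by elim: n bs xs => [|n IH] [|b bs] [|x xs] //= [h /IH]. Qed.

Lemma in_balls_behead bs xs : in_balls bs xs -> in_balls (behead bs) (behead xs).
Proof. by case: bs xs => [|b bs] [|x xs] //= []. Qed.

Lemma in_balls_nth bs xs i : in_balls bs xs -> in_ball (nth b0 bs i) (nth 0 xs i).
Proof.
elim: bs xs i => [|b bs IH] [|x xs] i //=; first by rewrite !nth_nil => _; apply/in_b0.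
by case=> h /IH hi; case: i.
Qed.

Lemma in_balls_last b x bs xs : in_ball b x -> in_balls bs xs -> in_ball (last b bs) (last x xs).
Proof. by elim: bs xs b x => [|b' bs IH] [|x' xs] b x //= h [h' /IH]; apply. Qed.

Lemma exist_lens ys : all link_ok ys -> List.Forall (fun y : link => realizable y.1.1) ys ->
  exists2 ls, have_lens ys ls & in_balls (map link_len ys) ls.
Proof.
elim: ys => [|y ys IH] /=; first by exists [::].
case/andP=> /and3P[t0 t1 _] oks /List.Forall_cons_iff[[qs hq] /(IH oks)[ls h1 h2]].
exists (sqdist (nth p0 qs y.2) (nth p0 qs y.1.2) :: ls); split=> //; first by exists qs.
by case: hq => sq nq _; apply: in_bsqdist; apply: nq; rewrite sq.
Qed.

(** Realizations of the links are chosen first. Their tip distances, known only up to balls, are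
    then the sides from which the exact polygon is built. *)
Lemma ring_realizable ys ds :
  ring_ok ys ds -> List.Forall (fun y : link => realizable y.1.1) ys ->
  realizable (ring ys ds).
Proof.
rewrite /ring_ok /ring; set bl := map link_len ys; set m := (size ys).-2.
set D := rcons _ _; move=> /and5P[s1 /eqP sd m0 oks /andP[ps fok]] reas.
have [ls hl bls] := exist_lens oks reas.
have szb : size bl = size ys by rewrite size_map.
have szl : size ls = size ys by rewrite -szb (in_balls_size bls).
set d := rcons [seq (IZR z / U) * (IZR z / U) | z <- ds] (last 0 ls).
have hD : in_balls D d.
  rewrite /D /d -!cats1; apply: in_balls_cat; last first.
    by split=> //; apply: in_balls_last => //; apply/in_b0.
  by elim: (ds) => //= z zs IH; split=> //; apply: in_bmul; apply: in_ball_const.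
have hL : in_balls (take m (behead bl)) (take m (behead ls)).
  by apply: in_balls_take; apply: in_balls_behead.
have hl0 : in_ball (head b0 bl) (head 0 ls).
  by rewrite -!nth0; apply: in_balls_nth.
have l0pos := positive_gt0 ps hl0.
set v : point := (sqrt (head 0 ls), 0).
have hv : near (bsqrt (head b0 bl), b0) v.
  by split; [apply: in_bsqrt | apply/in_b0].
have szm : size (take m (behead ls)) = size d.
  rewrite size_rcons size_map sd size_takel ?prednK //.
  by rewrite size_behead szl /m leq_pred.
have [hn hc] := fanP fok hv hL hD szm.
have vv : sqdist v p0 = head 0 ls.
  by rewrite /sqdist /v /=; rewrite !Rminus_0_r Rmult_0_l Rplus_0_r sqrt_sqrt //; lra.
apply: (attach_realizable (ps := p0 :: v :: fan v (take m (behead ls)) d) (ls := ls)) => //.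
- split=> //=.
  + by rewrite size_fan size_bfan !size_take !size_behead szb szl.
  + case=> [|[|i]] h; [exact: near_p0 | exact: hv | apply: hn].
    by rewrite /= size_fan !ltnS in h.
- have := hc [:: p0] erefl => /= c.
  (* The sides are the one on the axis, those spent on the fan, and the last one, which the fan used
     as its final diagonal. *)
  have lsE : ls = head 0 ls :: rcons (take m (behead ls)) (last (sqdist v p0) d).
    rewrite /d last_rcons.
    case: (ls) szl s1 m0 => [|x xs]; first by move=> /= <-.
    rewrite /m => <- /=; case/lastP: xs => [|xs z] //= _ _.
    by rewrite size_rcons /= last_rcons -!cats1 take_size_cat.
  rewrite [X in chain _ _ X]lsE.
  split; last exact: c.
  case: (rcons _ _) (size_rcons (take m (behead ls)) (last (sqdist v p0) d)) => // _ _ _.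
- rewrite add0n /= size_fan szm /d size_rcons size_map sd /m.
  by case: (size ys) s1 m0 => [|[|[|k]]].
Qed.

(** * Newton's method as a contraction *)

(** Banach's fixed point theorem in a cube for the sup norm. Vectors are functions on [nat], so no
    dimension occurs; the iterates of [0] converge in each coordinate, with a geometric bound common
    to all coordinates. *)
Lemma contraction_fixpoint (G : (nat -> R) -> nat -> R) (rho : R) : 0 <= rho ->
  (forall y, (forall i, Rabs (y i) <= rho) -> forall i, Rabs (G y i) <= rho) ->
  (forall y y' d, (forall i, Rabs (y i) <= rho) -> (forall i, Rabs (y' i) <= rho) ->
     (forall i, Rabs (y i - y' i) <= d) -> forall i, Rabs (G y i - G y' i) <= d / 2) ->
  exists2 y, (forall i, Rabs (y i) <= rho) & forall i, G y i = y i.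
Proof.
move=> r0 box contr.
pose s n := ssrnat.iter n G (fun=> 0).
have sbox n i : Rabs (s n i) <= rho.
  elim: n i => [|n IH] i /=; first by rewrite Rabs_R0.
  exact: box.
have step n i : Rabs (s n.+1 i - s n i) <= rho * (/ 2) ^ n.
  elim: n i => [|n IH] i.
    by rewrite /= Rmult_1_r Rminus_0_r; apply: (sbox 1%N).
  have := contr _ _ _ (sbox n.+1) (sbox n) IH i => /=; lra.
have half_gt0 n : 0 < (/ 2) ^ n by apply: pow_lt; lra.
(* The subtracted term makes the telescoping sum an induction on [k]. *)
have far n k i : Rabs (s (n + k)%N i - s n i) <= 2 * rho * (/ 2) ^ n - 2 * rho * (/ 2) ^ (n + k).
  elim: k => [|k IH].
    rewrite addn0 !Rminus_diag Rabs_R0; lra.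
  have -> : s (n + k.+1)%N i - s n i = (s (n + k).+1 i - s (n + k)%N i) + (s (n + k)%N i - s n i) by rewrite addnS; ring.
  apply: Rle_trans (Rabs_triang _ _) _.
  have := step (n + k)%N i; rewrite addnS /=; move: IH; lra.
have far' n m i : (n <= m)%N -> Rabs (s m i - s n i) <= 2 * rho * (/ 2) ^ n.
  move=> nm; have := far n (m - n)%N i; rewrite subnKC // => h.
  apply: Rle_trans h _; have := half_gt0 m; nra.
have small (eps : R) : 0 < eps -> exists n, 2 * rho * (/ 2) ^ n < eps.
  move=> e0.
  have [n hn] := pow_lt_1_zero (/ 2) ltac:(rewrite Rabs_pos_eq; lra) (eps / (2 * rho + 1)) ltac:(apply: Rdiv_lt_0_compat; lra).
  exists n; have := hn n (le_n n); rewrite Rabs_pos_eq; last by left.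
  move=> h; have h2 : (/ 2) ^ n * (2 * rho + 1) < eps.
    apply: (Rlt_le_trans _ (eps / (2 * rho + 1) * (2 * rho + 1))); first by apply: Rmult_lt_compat_r; lra.
    by right; field; lra.
  have := half_gt0 n; nra.
have lim i : { l | Un_cv (s^~ i) l }.
  apply: R_complete => eps e0.
  have [N hN] := small (eps / 2) ltac:(lra).
  exists N => n m /leP hn /leP hm; rewrite /R_dist.
  have := far' N n i hn; have := far' N m i hm.
  have -> : s n i - s m i = (s n i - s N i) - (s m i - s N i) by ring.
  have := Rabs_triang (s n i - s N i) (- (s m i - s N i)); rewrite Rabs_Ropp; rewrite /Rminus; lra.
pose y i := proj1_sig (lim i).
have ylim n i : Rabs (y i - s n i) <= 2 * rho * (/ 2) ^ n.
  apply: le_epsilon => eps e0; rewrite /y; case: (lim i) => l /= hl.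
  have [N hN] := hl eps e0.
  have := hN (maxn n N) (leP (leq_maxr n N)); rewrite /R_dist.
  have := far' n (maxn n N) i (leq_maxl n N).
  have -> : l - s n i = (s (maxn n N) i - s n i) - (s (maxn n N) i - l) by ring.
  have := Rabs_triang (s (maxn n N) i - s n i) (- (s (maxn n N) i - l)); rewrite Rabs_Ropp /Rminus; lra.
have ybox i : Rabs (y i) <= rho.
  apply: le_epsilon => eps e0; have [n hn] := small eps e0.
  have := ylim n i; have := sbox n i.
  have -> : y i = s n i + (y i - s n i) by ring.
  have := Rabs_triang (s n i) (y i - s n i).
  have -> : s n i + (y i - s n i) = y i by ring.
  lra.
exists y => // i; apply: cond_eq => eps e0.
have [n hn] := small (eps / 2) ltac:(lra).
(* [G y] is compared with [G (s n)], the next iterate, which is itself close to [y]. *)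
have h1 := contr _ _ _ ybox (sbox n) (ylim n) i.
have h2 := ylim n.+1 i.
have -> : G y i - y i = (G y i - G (s n) i) - (y i - s n.+1 i) by rewrite /=; ring.
have := Rabs_triang (G y i - G (s n) i) (- (y i - s n.+1 i)); rewrite Rabs_Ropp.
move: h2 => /= h2; have := half_gt0 n; rewrite /Rminus in h1 h2 *; nra.
Qed.

Fixpoint dot (r : seq Z) (y : nat -> R) : R :=
  if r is a :: r' then IZR a * y 0%N + dot r' (fun n => y n.+1) else 0.

Definition norm1 (r : seq Z) : Z := foldr (fun a s => Z.abs a + s)%Z 0%Z r.

Fixpoint lincomb (a : Z) (r : seq Z) (b : Z) (s : seq Z) : seq Z :=
  match r, s with
  | x :: r', y :: s' => (a * x + b * y)%Z :: lincomb a r' b s'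
  | _, _ => [::]
  end.

Lemma dot_lincomb a r b s y : size r = size s ->
  dot (lincomb a r b s) y = IZR a * dot r y + IZR b * dot s y.
Proof.
elim: r s y => [|x r IH] [|z s] y //=; first by move=> _; ring.
by move=> [e]; rewrite IH // plus_IZR !mult_IZR; ring.
Qed.

Lemma size_lincomb a r b s : size r = size s -> size (lincomb a r b s) = size s.
Proof. by elim: r s => [|x r IH] [|z s] //= [/IH ->]. Qed.

Lemma dot_bound r y rho : (forall i, Rabs (y i) <= rho) -> Rabs (dot r y) <= IZR (norm1 r) * rho.
Proof.
elim: r y => [|a r IH] y h /=; first by rewrite Rabs_R0; lra.
apply: Rle_trans (Rabs_triang _ _) _; rewrite plus_IZR Rmult_plus_distr_r Rabs_mult abs_IZR.
apply: Rplus_le_compat; first by apply: Rmult_le_compat_l => //; apply: Rabs_pos.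
exact: IH.
Qed.

Lemma dot_sub r y y' : dot r y - dot r y' = dot r (fun i => y i - y' i).
Proof. by elim: r y y' => [|a r IH] y y' /=; [ring | rewrite -IH; ring]. Qed.

Definition unitrow m e : seq Z := [seq if i == e then 1%Z else 0%Z | i <- iota 0 m].

Lemma dot_unitrow m e y : (e < m)%N -> dot (unitrow m e) y = y e.
Proof.
have z n k (z : nat -> R) : (e < k)%N -> dot [seq if i == e then 1%Z else 0%Z | i <- iota k n] z = 0.
  elim: n k z => //= n IH k z ek; rewrite IH ?ltnS 1?ltnW //.
  by rewrite gtn_eqF //; ring.
have g n k (w : nat -> R) : (k <= e)%N -> (e < k + n)%N ->
    dot [seq if i == e then 1%Z else 0%Z | i <- iota k n] w = w (e - k)%N.
  elim: n k w => [|n IH] k w ke; first by rewrite addn0 ltnNge ke.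
  rewrite /= => h; case: (eqVneq k e) => [kE|ne].
    by rewrite kE subnn z //; ring.
  have ke' : (k < e)%N by rewrite ltn_neqAle ne.
  rewrite IH //; last by rewrite addSnnS.
  by rewrite subnS prednK ?subn_gt0 //; ring.
by move=> em; rewrite /unitrow g // subn0.
Qed.

(** The rows of the approximate inverse are integers in units of [10 ^ -9], while coordinates are in
    units of [2 ^ -40]. *)
Definition rowZ : Z := 1000000000.
Notation S := (IZR rowZ).

Lemma S_gt0 : 0 < S. Proof. by apply: IZR_lt. Qed.

Lemma dot_diff r s y : size r = size s -> dot (lincomb 1 r (-1) s) y = dot r y - dot s y.
Proof. by move=> e; rewrite dot_lincomb //; ring. Qed.

(** With [t] the parameter belonging to an edge, the Newton map is split into a constant part, the
    residual, a linear part, the defect of the inverse, and a quadratic part. *)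
Lemma newton_identity (t ax ay bx b_y p q p' q' u s : R) : u <> 0 -> s <> 0 ->
  t - ((ax / u + p / s - (bx / u + q / s)) * (ax / u + p / s - (bx / u + q / s)) +
       (ay / u + p' / s - (b_y / u + q' / s)) * (ay / u + p' / s - (b_y / u + q' / s)) - 1) =
  - (((ax - bx) * (ax - bx) + (ay - b_y) * (ay - b_y) - u * u) / (u * u)) +
  (s * u * t + -2 * ((ax - bx) * (p - q) + (ay - b_y) * (p' - q'))) / (s * u) -
  ((p - q) / s * ((p - q) / s) + (p' - q') / s * ((p' - q') / s)).
Proof. by move=> u0 s0; field. Qed.

Lemma abs_sum4 a b c d a' b' c' d' :
  Rabs a <= a' -> Rabs b <= b' -> Rabs c <= c' -> Rabs d <= d' ->
  Rabs (- a + b - (c + d)) <= a' + b' + c' + d'.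
Proof. by move=> ? ? ? ?; split_Rabs; lra. Qed.

Lemma abs_sum3 a b c a' b' c' :
  Rabs a <= a' -> Rabs b <= b' -> Rabs c <= c' -> Rabs (a - b - c) <= a' + b' + c'.
Proof. by move=> ? ? ?; split_Rabs; lra. Qed.

Section Newton.
Variables (zs : seq (Z * Z)) (es : seq (nat * nat)) (A : seq (seq Z * seq Z)).
Local Notation m := (size es).

Definition zpt i := nth (0, 0)%Z zs i.
Definition rows i := nth ([::], [::]) A i.

Definition edx (e : nat * nat) := ((zpt e.1).1 - (zpt e.2).1)%Z.
Definition edy (e : nat * nat) := ((zpt e.1).2 - (zpt e.2).2)%Z.
Definition residual e := (edx e * edx e + edy e * edy e - unitZ * unitZ)%Z.
Definition rowx (e : nat * nat) := lincomb 1 (rows e.1).1 (-1) (rows e.2).1.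
Definition rowy (e : nat * nat) := lincomb 1 (rows e.1).2 (-1) (rows e.2).2.
(** Row [k] of the identity minus the Jacobian times [A], scaled by [rowZ * unitZ]. *)
Definition defect k (e : nat * nat) :=
  lincomb (rowZ * unitZ) (unitrow m k) (-2) (lincomb (edx e) (rowx e) (edy e) (rowy e)).

(* [rho] bounds the parameters, [eta] the defect of [A] as a right inverse of the
   Jacobian, [mu] the rows of [A], and [res] the residuals. *)
Definition newton_ok (rho eta mu res : Z) :=
  [&& (0 <=? rho)%Z, size A == size zs,
      all (fun r => (size r.1 == m) && (size r.2 == m)) A,
      all (fun e => (e.1 < size zs)%N && (e.2 < size zs)%N) es,
      all (fun e => [&& (Z.abs (residual e) <=? res)%Z, (norm1 (rowx e) <=? mu)%Z &
                       (norm1 (rowy e) <=? mu)%Z]) es,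
      all (fun ke => norm1 (defect ke.1 ke.2) <=? eta)%Z (zip (iota 0 m) es),
      (res * (rowZ * rowZ) + eta * rho * rowZ + 2 * (mu * mu) * (rho * rho) <=?
         rho * unitZ * (rowZ * rowZ))%Z &
      (2 * (eta * rowZ + 4 * (mu * mu) * rho) <=? unitZ * (rowZ * rowZ))%Z].

Definition ptA (y : nat -> R) i : point :=
  (IZR (zpt i).1 / U + dot (rows i).1 y / S, IZR (zpt i).2 / U + dot (rows i).2 y / S).

Definition ceil_div (a b : Z) := ((a + b - 1) / b)%Z.
(** The solution moves a coordinate by at most the 1-norm of its row times [rho]. A zero row gives
    radius zero, so a coordinate kept at zero is known exactly. *)
Definition newton_fig (rho : Z) :=
  Fig [seq ((zr.1.1, ceil_div (norm1 zr.2.1 * rho) rowZ),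
            (zr.1.2, ceil_div (norm1 zr.2.2 * rho) rowZ)) | zr <- zip zs A] es.

Lemma ceil_divP a b : (0 < b)%Z -> IZR a / IZR b <= IZR (ceil_div a b).
Proof.
move=> b0; have B0 : 0 < IZR b by apply: IZR_lt.
apply: (Rmult_le_reg_r (IZR b)) => //.
have -> : IZR a / IZR b * IZR b = IZR a by field; lra.
rewrite -mult_IZR; apply: IZR_le; rewrite /ceil_div.
have := Z.mod_pos_bound (a + b - 1) b b0; have := Z.div_mod (a + b - 1) b; nia.
Qed.

Lemma newton_realizable rho eta mu res :
  newton_ok rho eta mu res -> realizable (newton_fig rho).
Proof.
case/and5P=> /Z.leb_spec0 rho0 /eqP sA /(all_nthP ([::], [::])) sr /allP er /and4P[/allP hb /allP hd].
move=> /Z.leb_spec0 /IZR_le c1 /Z.leb_spec0 /IZR_le c2.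
have u0 := U_gt0; have s0 := S_gt0.
pose r := IZR rho / U.
have r0 : 0 <= r by apply: Rmult_le_pos; [apply: IZR_le | left; apply: Rinv_0_lt_compat].
(* There is one parameter per edge; the components beyond are zero, since the fixed point lemma
   works on all of [nat]. *)
pose G y k := if (k < m)%N then
  y k - (sqdist (ptA y (nth (0, 0)%N es k).1) (ptA y (nth (0, 0)%N es k).2) - 1) else 0.
pose gx y (e : nat * nat) := dot (rowx e) y / S; pose gy y (e : nat * nat) := dot (rowy e) y / S.
have szr i : (i < size zs)%N -> size (rows i).1 = m /\ size (rows i).2 = m.
  by rewrite -sA => hi; have /andP[/eqP ? /eqP ?] := sr _ hi.
have rowE e y : e \in es -> dot (rowx e) y = dot (rows e.1).1 y - dot (rows e.2).1 y /\
    dot (rowy e) y = dot (rows e.1).2 y - dot (rows e.2).2 y.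
  move=> /er /andP[/szr [a1 a2] /szr [b1 b2]].
  by split; apply: dot_diff; rewrite ?a1 ?a2.
have srow e : e \in es -> size (rowx e) = m /\ size (rowy e) = m.
  move=> /er /andP[/szr [a1 a2] /szr [b1 b2]].
  by rewrite /rowx /rowy !size_lincomb ?a1 ?a2 ?b1 ?b2.
have GE y k : (k < m)%N -> let e := nth (0, 0)%N es k in
    G y k = - (IZR (residual e) / (U * U)) + dot (defect k e) y / (S * U)
            - (gx y e * gx y e + gy y e * gy y e).
  move=> km e; have ein : e \in es by apply: mem_nth.
  have [x1 x2] := rowE e y ein; have [z1 z2] := srow e ein.
  rewrite /G km -/e /defect dot_lincomb; last first.
    by rewrite size_lincomb ?z1 // size_map size_iota.
  rewrite dot_unitrow // dot_lincomb ?z1 // /gx /gy x1 x2 (mult_IZR rowZ).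
  rewrite /sqdist /ptA /= /residual !minus_IZR !plus_IZR !mult_IZR /edx /edy !minus_IZR.
  by apply: newton_identity; lra.
have gb y (d : R) e : e \in es -> (forall i, Rabs (y i) <= d) ->
    Rabs (gx y e) <= IZR mu / S * d /\ Rabs (gy y e) <= IZR mu / S * d.
  move=> /hb /and3P[_ /Z.leb_spec0 /IZR_le h1 /Z.leb_spec0 /IZR_le h2] hy.
  have d0 : 0 <= d by apply: Rle_trans (hy 0%N); apply: Rabs_pos.
  have is0 : 0 < / S by apply: Rinv_0_lt_compat.
  rewrite /gx /gy /Rdiv !Rabs_mult !(Rabs_right (/ S)); try lra.
  have := dot_bound (rowx e) hy; have := dot_bound (rowy e) hy => k1 k2.
  split.
    have -> : IZR mu * / S * d = (IZR mu * d) * / S by ring.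
    apply: Rmult_le_compat_r; first lra.
    by apply: Rle_trans k2 _; apply: Rmult_le_compat_r.
  have -> : IZR mu * / S * d = (IZR mu * d) * / S by ring.
  apply: Rmult_le_compat_r; first lra.
  by apply: Rle_trans k1 _; apply: Rmult_le_compat_r.
have db y (d : R) k : (k < m)%N -> (forall i, Rabs (y i) <= d) ->
    Rabs (dot (defect k (nth (0, 0)%N es k)) y / (S * U)) <= IZR eta / (S * U) * d.
  move=> km hy; have d0 : 0 <= d by apply: Rle_trans (hy 0%N); apply: Rabs_pos.
  have is0 : 0 < / (S * U) by apply: Rinv_0_lt_compat; apply: Rmult_lt_0_compat.
  rewrite /Rdiv Rabs_mult (Rabs_right (/ (S * U))); last by lra.
  have -> : IZR eta * / (S * U) * d = (IZR eta * d) * / (S * U) by ring.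
  apply: Rmult_le_compat_r; first lra.
  apply: Rle_trans (dot_bound _ hy) _; apply: Rmult_le_compat_r => //; apply: IZR_le.
  apply/Z.leb_spec0; apply: (hd (k, nth (0, 0)%N es k)).
  have -> : (k, nth (0, 0)%N es k) = nth (0%N, (0, 0)%N) (zip (iota 0 m) es) k.
    by rewrite nth_zip ?size_iota // nth_iota.
  by apply: mem_nth; rewrite size_zip size_iota minnn.
(* This is the last inequality of [newton_ok]: the linear and quadratic parts together contract by
   one half. *)
have half : IZR eta / (S * U) + 4 * (IZR mu / S) * (IZR mu / S) * r <= / 2.
  have -> : IZR eta / (S * U) + 4 * (IZR mu / S) * (IZR mu / S) * r =
     (2 * (IZR eta * S + 4 * (IZR mu * IZR mu) * IZR rho)) / (U * (S * S)) / 2.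
    by rewrite /r; field; lra.
  rewrite !mult_IZR plus_IZR !mult_IZR in c2.
  have p0 : 0 < U * (S * S) by apply: Rmult_lt_0_compat => //; apply: Rmult_lt_0_compat.
  suff : 2 * (IZR eta * S + 4 * (IZR mu * IZR mu) * IZR rho) / (U * (S * S)) <= 1 by lra.
  apply: (Rmult_le_reg_r (U * (S * S))) => //.
  by rewrite /Rdiv Rmult_assoc Rinv_l; lra.
have mu0 e : e \in es -> 0 <= IZR mu / S.
  move=> /hb /and3P[_ /Z.leb_spec0 /IZR_le h1 _].
  have := dot_bound (rowx e) (rho := 1) (y := fun=> 1) (fun i => ltac:(rewrite Rabs_R1; lra)).
  move=> h2; apply: Rmult_le_pos; last by left; apply: Rinv_0_lt_compat.
  have := Rabs_pos (dot (rowx e) (fun=> 1)); lra.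
have [y ybox yfix] : exists2 y, (forall i, Rabs (y i) <= r) & forall i, G y i = y i.
  apply: contraction_fixpoint => //.
  - move=> y hy k; case: (ltnP k m) => km; last by rewrite /G ltnNge km /= Rabs_R0.
    have ein : nth (0, 0)%N es k \in es by apply: mem_nth.
    rewrite GE //; set e := nth _ es k in ein *.
    have [g1 g2] := gb y r e ein hy; have d1 := db y r k km hy; rewrite -/e in d1.
    have m0 := mu0 e ein.
    have q1 : Rabs (gx y e * gx y e) <= (IZR mu / S * r) * (IZR mu / S * r).
      by rewrite Rabs_mult; apply: Rmult_le_compat => //; apply: Rabs_pos.
    have q2 : Rabs (gy y e * gy y e) <= (IZR mu / S * r) * (IZR mu / S * r).
      by rewrite Rabs_mult; apply: Rmult_le_compat => //; apply: Rabs_pos.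
    have t1 : Rabs (IZR (residual e) / (U * U)) <= IZR res / (U * U).
      have i0 : 0 < / (U * U) by apply: Rinv_0_lt_compat; apply: Rmult_lt_0_compat.
      rewrite /Rdiv Rabs_mult (Rabs_right (/ (U * U))); last by lra.
      apply: Rmult_le_compat_r; first lra.
      by rewrite -abs_IZR; apply: IZR_le; have /and3P[/Z.leb_spec0] := hb e ein.
    (* This is the other inequality of [newton_ok]: the cube is mapped into itself. *)
    have tot : IZR res / (U * U) + IZR eta / (S * U) * r + 2 * ((IZR mu / S * r) * (IZR mu / S * r)) <= r.
      have -> : IZR res / (U * U) + IZR eta / (S * U) * r + 2 * ((IZR mu / S * r) * (IZR mu / S * r)) =
         (IZR res * (S * S) + IZR eta * IZR rho * S + 2 * (IZR mu * IZR mu) * (IZR rho * IZR rho)) / (U * U * (S * S)).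
        by rewrite /r; field; lra.
      have p0 : 0 < U * U * (S * S) by apply: Rmult_lt_0_compat; apply: Rmult_lt_0_compat.
      apply: (Rmult_le_reg_r (U * U * (S * S))) => //.
      rewrite !plus_IZR !mult_IZR in c1.
      have -> : r * (U * U * (S * S)) = IZR rho * U * (S * S) by rewrite /r; field; lra.
      by rewrite {1}/Rdiv Rmult_assoc Rinv_l; lra.
    by apply: Rle_trans (abs_sum4 t1 d1 q1 q2) _; lra.
  - move=> y y' d hy hy' hd' k; case: (ltnP k m) => km; last first.
      rewrite /G ltnNge km /= Rminus_diag Rabs_R0.
      by have : 0 <= d by [apply: Rle_trans (hd' 0%N); apply: Rabs_pos]; lra.
    have d0 : 0 <= d by apply: Rle_trans (hd' 0%N); apply: Rabs_pos.
    have ein : nth (0, 0)%N es k \in es by apply: mem_nth.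
    rewrite !GE //; set e := nth _ es k in ein *.
    have [g1 g2] := gb y r e ein hy; have [g3 g4] := gb y' r e ein hy'.
    have [g5 g6] := gb _ d e ein hd'; have d1 := db _ d k km hd'; rewrite -/e in d1.
    have m0 := mu0 e ein.
    have x5 : gx (fun i => y i - y' i) e = gx y e - gx y' e by rewrite /gx -dot_sub; field; lra.
    have x6 : gy (fun i => y i - y' i) e = gy y e - gy y' e by rewrite /gy -dot_sub; field; lra.
    rewrite x5 in g5; rewrite x6 in g6.
    set a := IZR mu / S in m0 g1 g2 g3 g4 g5 g6 half.
    have sq (u v : R) : Rabs u <= a * r -> Rabs v <= a * r -> Rabs (u - v) <= a * d ->
        Rabs (u * u - v * v) <= 2 * a * a * r * d.
      move=> h1 h2 h3; have -> : u * u - v * v = (u - v) * (u + v) by ring.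
      rewrite Rabs_mult; have -> : 2 * a * a * r * d = (a * d) * (2 * (a * r)) by ring.
      apply: Rmult_le_compat => //; try exact: Rabs_pos.
      by have := Rabs_triang u v; lra.
    have q1 := sq _ _ g1 g3 g5; have q2 := sq _ _ g2 g4 g6.
    have -> : - (IZR (residual e) / (U * U)) + dot (defect k e) y / (S * U) - (gx y e * gx y e + gy y e * gy y e) -
      (- (IZR (residual e) / (U * U)) + dot (defect k e) y' / (S * U) - (gx y' e * gx y' e + gy y' e * gy y' e)) =
      dot (defect k e) (fun i => y i - y' i) / (S * U) - (gx y e * gx y e - gx y' e * gx y' e) - (gy y e * gy y e - gy y' e * gy y' e).
      by rewrite -dot_sub; field; lra.
    have tot : IZR eta / (S * U) * d + 4 * a * a * r * d <= d / 2.
      have := Rmult_le_compat_r d _ _ d0 half; lra.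
    by apply: Rle_trans (abs_sum3 d1 q1 q2) _; lra.
exists [seq ptA y i | i <- iota 0 (size zs)]; split.
- by rewrite size_map size_iota size_map size_zip sA minnn.
- move=> i; rewrite size_map size_iota => hi.
  rewrite (nth_map 0%N) ?size_iota // nth_iota // add0n /fnth /newton_fig /=.
  rewrite (nth_map ((0, 0)%Z, ([::], [::]))) ?size_zip ?sA ?minnn //= nth_zip //=.
  rewrite -/(zpt i) -/(rows i).
  have bd (z : Z) row : in_ball (z, ceil_div (norm1 row * rho) rowZ) (IZR z / U + dot row y / S).
    rewrite /in_ball /=.
    have -> : (IZR z / U + dot row y / S) * U - IZR z = dot row y * (U / S) by field; lra.
    apply: Rle_trans (ceil_divP _ (erefl : (0 < rowZ)%Z)).
    have us : 0 < U / S by apply: Rdiv_lt_0_compat.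
    rewrite Rabs_mult (Rabs_right (U / S)) ?mult_IZR; last by lra.
    have -> : IZR (norm1 row) * IZR rho / S = (IZR (norm1 row) * r) * (U / S) by rewrite /r; field; lra.
    by apply: Rmult_le_compat_r; [lra | apply: dot_bound].
  by split; apply: bd.
- move=> e ein; rewrite size_map size_iota; have /andP[h1 h2] := er e ein.
  split=> //; rewrite !(nth_map 0%N) ?size_iota // !nth_iota // !add0n.
  have km : (index e es < m)%N by rewrite index_mem.
  (* At a fixed point the component of an edge says that its squared length is one. *)
  have cancel (x q : R) : x - (q - 1) = x -> q = 1 by move=> ?; lra.
  by apply: (cancel (y (index e es))); have := yfix (index e es); rewrite /G km nth_index.
Qed.
End Newton.

(** * Computing approximate solutions and inverses *)

(** This is partial pivoting. Nothing is proved about the elimination: its outcome is only a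
    candidate, which [newton_ok] certifies afterwards. *)
Fixpoint pick_max (best : seq Z) (acc rest : seq (seq Z)) : seq Z * seq (seq Z) :=
  if rest is r :: rest' then
    if (Z.abs (head 0%Z best) <? Z.abs (head 0%Z r))%Z then pick_max r (best :: acc) rest'
    else pick_max best (r :: acc) rest'
  else (best, acc).

Fixpoint eliminate (c : Z) (t r : seq Z) : seq Z :=
  match t, r with
  | x :: t', y :: r' => (y - c * x / rowZ)%Z :: eliminate c t' r'
  | _, _ => [::]
  end.

(* Gauss-Jordan elimination: each step consumes the first column of all rows. *)
Fixpoint gauss (n : nat) (done rest : seq (seq Z)) : seq (seq Z) :=
  match n, rest with
  | n'.+1, r :: rest' =>
    let pr := pick_max r [::] rest' in
    let c := head 0%Z pr.1 in
    let t := [seq (x * rowZ / c)%Z | x <- behead pr.1] in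
    let elim s := eliminate (head 0%Z s) t (behead s) in
    gauss n' (rcons (map elim done) t) (map elim pr.2)
  | _, _ => done
  end.

(** The Jacobian is augmented by the identity, so that eliminating its columns leaves the
    inverse. *)
Definition jacobian_row (zs : seq (Z * Z)) n (cols : seq (nat * bool)) ke :=
  let: (k, e) := ke in
  let sc x := (2 * x * rowZ / unitZ)%Z in
  [seq (let d := if c.2 then edy zs e else edx zs e in
        if c.1 == e.1 then sc d else if c.1 == e.2 then sc (- d)%Z else 0%Z) | c <- cols]
  ++ [seq if i == k then rowZ else 0%Z | i <- iota 0 n].

(* A coordinate given as [0] is kept equal to [0]; the others are unknowns. *)
Definition right_inverse (zs : seq (Z * Z)) (es : seq (nat * nat)) : seq (seq Z * seq Z) :=
  let n := size es in
  let cols := flatten [seq (if (zpt zs i).1 =? 0 then [::] else [:: (i, false)])%Z ++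
                          (if (zpt zs i).2 =? 0 then [::] else [:: (i, true)])%Z
                      | i <- iota 0 (size zs)] in
  let inv := gauss n [::] [seq jacobian_row zs n cols ke | ke <- zip (iota 0 n) es] in
  let row i b := nth (nseq n 0%Z) inv (index (i, b) cols) in
  [seq (row i false, row i true) | i <- iota 0 (size zs)].

Fixpoint dotZ (r s : seq Z) : Z :=
  match r, s with x :: r', y :: s' => (x * y + dotZ r' s')%Z | _, _ => 0%Z end.

Definition newton_step (es : seq (nat * nat)) A (zs : seq (Z * Z)) :=
  let f := [seq (residual zs e / unitZ)%Z | e <- es] in
  [seq ((za.1.1 - dotZ za.2.1 f / rowZ)%Z, (za.1.2 - dotZ za.2.2 f / rowZ)%Z) | za <- zip zs A].

(** All three steps use the inverse computed at the starting point. *)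
Definition refine (d : seq (Z * Z)) es :=
  let zs := [seq ((z.1 * unitZ / 1000000)%Z, (z.2 * unitZ / 1000000)%Z) | z <- d] in
  let A := right_inverse zs es in
  (ssrnat.iter 3 (newton_step es A) zs, A).

(** * Separating points and segments *)

Definition apart (a b : ball) := (a.2 + b.2 <? Z.abs (a.1 - b.1))%Z.

Lemma apartP a b x y : apart a b -> in_ball a x -> in_ball b y -> x <> y.
Proof.
move=> /Z.ltb_spec0 /IZR_lt; rewrite plus_IZR abs_IZR minus_IZR /in_ball => h ha hb e.
move: h ha hb; rewrite e; split_Rabs; lra.
Qed.

Definition upper (al be : Z) (p : bpoint) :=
  (al * p.1.1 + Z.abs al * p.1.2 + (be * p.2.1 + Z.abs be * p.2.2))%Z.

Lemma upperP al be b p : near b p ->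
  (IZR al * p.1 + IZR be * p.2) * U <= IZR (upper al be b).
Proof.
have lin (c : Z) a x : in_ball a x -> IZR c * x * U <= IZR c * IZR a.1 + Rabs (IZR c) * IZR a.2.
  move=> /in_ballP[d [e h1 h2]].
  have -> : IZR c * x * U = IZR c * IZR a.1 + IZR c * d by rewrite Rmult_assoc e; ring.
  apply: Rplus_le_compat_l; apply: Rle_trans (Rle_abs _) _; rewrite Rabs_mult.
  by apply: Rmult_le_compat_l; [apply: Rabs_pos | apply: Rabs_le; lra].
case=> /(lin al) h1 /(lin be) h2.
rewrite /upper !plus_IZR !mult_IZR !abs_IZR; lra.
Qed.

Definition segment := (bpoint * bpoint)%type.

Definition extent (al be : Z) (s : segment) :=
  Z.max (upper al be s.1) (upper al be s.2).

(** A linear functional is largest at an end of a segment, and its least value on [t] is minus the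
    largest value of its negative. So upper bounds suffice to find a line strictly between the two
    segments. *)
Definition cut (al be : Z) (s t : segment) :=
  (extent al be s <? - extent (- al) (- be) t)%Z.

Lemma cutP al be s t a b c d q : cut al be s t ->
  near s.1 a -> near s.2 b -> near t.1 c -> near t.2 d ->
  on_segment a b q -> on_segment c d q -> False.
Proof.
rewrite /cut /extent; move=> /Z.ltb_spec0 h /(upperP al be) ha /(upperP al be) hb.
move=> /(upperP (- al) (- be)) hc /(upperP (- al) (- be)) hd.
move=> [u [hu [q1 q2]]] [v [hv [q3 q4]]].
set A := upper al be s.1 in h ha; set B := upper al be s.2 in h hb.
set C := upper _ _ t.1 in h hc; set D := upper _ _ t.2 in h hd.
have [m1 m2 m3 m4] : [/\ IZR A <= IZR (Z.max A B), IZR B <= IZR (Z.max A B),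
    IZR C <= IZR (Z.max C D) & IZR D <= IZR (Z.max C D)] by split; apply: IZR_le; lia.
move/IZR_lt: h; rewrite opp_IZR => h.
rewrite !opp_IZR in hc hd.
have e1 : (IZR al * q.1 + IZR be * q.2) * U =
  (1 - u) * ((IZR al * a.1 + IZR be * a.2) * U) + u * ((IZR al * b.1 + IZR be * b.2) * U).
  by rewrite q1 q2; ring.
have e2 : - ((IZR al * q.1 + IZR be * q.2) * U) =
  (1 - v) * ((- IZR al * c.1 + - IZR be * c.2) * U) + v * ((- IZR al * d.1 + - IZR be * d.2) * U).
  by rewrite q3 q4; ring.
have : (IZR al * q.1 + IZR be * q.2) * U <= IZR (Z.max A B) by rewrite e1; nra.
have : - ((IZR al * q.1 + IZR be * q.2) * U) <= IZR (Z.max C D) by rewrite e2; nra.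
lra.
Qed.

(* Coarse bounding boxes: the kernel checks far fewer separations of edges with them. *)
Definition box (s : segment) : (Z * Z) * (Z * Z) :=
  ((Z.shiftr (- extent (-1) 0 s) 34, Z.shiftr (extent 1 0 s) 34),
   (Z.shiftr (- extent 0 (-1) s) 34, Z.shiftr (extent 0 1 s) 34)).

Definition boxes_apart (a b : (Z * Z) * (Z * Z)) :=
  (if a.1.2 <? b.1.1 then true else if b.1.2 <? a.1.1 then true else
   if a.2.2 <? b.2.1 then true else b.2.2 <? a.2.1)%Z.

(** Shifts are monotone, so a strict inequality between shifted bounds gives one between the bounds,
    that is, a [cut] along a coordinate axis. *)
Lemma boxes_apartP s t a b c d q : boxes_apart (box s) (box t) ->
  near s.1 a -> near s.2 b -> near t.1 c -> near t.2 d ->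
  on_segment a b q -> on_segment c d q -> False.
Proof.
have lt x y : (Z.shiftr x 34 <? Z.shiftr y 34)%Z -> (x <? y)%Z.
  move=> /Z.ltb_spec0; rewrite !Z.shiftr_div_pow2 // => h; apply/Z.ltb_spec0.
  by case: (Z_lt_le_dec x y) => // /(Z.div_le_mono _ _ (2 ^ 34) erefl); lia.
move=> + h1 h2 h3 h4 q1 q2.
rewrite /boxes_apart /box [fst in X in X -> _]/fst [snd in X in X -> _]/snd; do 3? case: ifP => [/lt h _|_]; last move=> /lt h.
- exact: (@cutP 1 0 s t a b c d q).
- exact: (@cutP 1 0 t s c d a b q).
- exact: (@cutP 0 1 s t a b c d q).
- exact: (@cutP 0 1 t s c d a b q).
Qed.

Definition cut2 al be s t := if cut al be s t then true else cut (- al) (- be) s t.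

(* Nested conditionals rather than disjunctions: [vm_compute] evaluates both arguments
   of [||]. Two disjoint segments are separated in a direction normal or parallel to one of them. *)
Definition separated (s t : segment) :=
  let dir (s : segment) :=
    (Z.shiftr (s.2.1.1 - s.1.1.1) 30, Z.shiftr (s.2.2.1 - s.1.2.1) 30) in
  let d := dir s in let e := dir t in
  if cut2 (- d.2) d.1 s t then true else if cut2 (- e.2) e.1 s t then true else
  if cut2 d.1 d.2 s t then true else cut2 e.1 e.2 s t.

Lemma separatedP s t a b c d q : separated s t ->
  near s.1 a -> near s.2 b -> near t.1 c -> near t.2 d ->
  on_segment a b q -> on_segment c d q -> False.
Proof.
move=> h ha hb hc hd hq1 hq2.
have two al be : cut2 al be s t -> False.
  by rewrite /cut2; case: ifP => h' => [_|h'']; [apply: (cutP h') | apply: (cutP h'')]; eassumption.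
move: h; rewrite /separated; repeat (case: ifP => [/two //|_]); exact: two.
Qed.

(** * From a checked figure to a 4-regular matchstick graph *)

Definition nbrs (es : seq (nat * nat)) i :=
  [seq e.2 | e <- es & e.1 == i] ++ [seq e.1 | e <- es & e.2 == i].

Definition meet (e f : nat * nat) :=
  [|| e.1 == f.1, e.1 == f.2, e.2 == f.1 | e.2 == f.2].

(** The box of each edge is computed once and carried along with it. Edges with a common end are
    exempt from separation; for them [unit_segments_meet] applies. *)
Definition matchstick_ok (n : nat) (F : fig) :=
  [&& size (fpts F) == n,
      all (fun e => e.1 != e.2) (fedges F),
      pairwise (fun a b => apart a.1 b.1 || apart a.2 b.2) (fpts F),
      pairwise (fun s t => if boxes_apart s.2.2 t.2.2 then true else
                           if meet s.1 t.1 then true else separated s.2.1 t.2.1)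
        [seq (let s := (fnth F e.1, fnth F e.2) in (e, (s, box s))) | e <- fedges F] &
      all (fun i => size (undup (nbrs (fedges F) i)) == 4%N) (iota 0 n)].

Lemma on_segmentC a b q : on_segment a b q -> on_segment b a q.
Proof.
by case=> t [ht [h1 h2]]; exists (1 - t); split; [lra|rewrite h1 h2]; split; ring.
Qed.

(** The parameter of [q] on a unit segment from [a] is its distance from [a], hence the same on
    both. Unless it is zero, [b] and [c] would coincide. *)
Lemma unit_segments_meet a b c q : sqdist a b = 1 -> sqdist a c = 1 -> b <> c ->
  on_segment a b q -> on_segment a c q -> q = a.
Proof.
case: a b c q => ax ay [bx b_y] [cx cy] [qx qy]; rewrite /sqdist /on_segment /=.
move=> hb hc ne [t [[t0 t1] [q1 q2]]] [s [[s0 s1] [q3 q4]]].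
have ts : t = s.
  have e1 : (qx - ax) * (qx - ax) + (qy - ay) * (qy - ay) = t * t.
    transitivity (t * t * ((ax - bx) * (ax - bx) + (ay - b_y) * (ay - b_y))); last by rewrite hb; ring.
    by rewrite q1 q2; ring.
  have e2 : (qx - ax) * (qx - ax) + (qy - ay) * (qy - ay) = s * s.
    transitivity (s * s * ((ax - cx) * (ax - cx) + (ay - cy) * (ay - cy))); last by rewrite hc; ring.
    by rewrite q3 q4; ring.
  have h : (t - s) * (t + s) = 0 by nra.
  by case: (Rmult_integral _ _ h) => h'; lra.
subst s; case: (Req_dec t 0) => [t0'|tn].
  by rewrite q1 q2 t0' !Rmult_0_l !Rplus_0_r.
case: ne; congr (_, _); apply: (Rmult_eq_reg_l t) => //; lra.
Qed.

Lemma mem_nbrs es i j : (j \in nbrs es i) = ((i, j) \in es) || ((j, i) \in es).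
Proof.
rewrite /nbrs mem_cat; congr (_ || _); apply/mapP/idP => /=.
- by case=> -[x y]; rewrite mem_filter /= => /andP[/eqP-> h] ->.
- by move=> h; exists (i, j); rewrite // mem_filter eqxx.
- by case=> -[x y]; rewrite mem_filter /= => /andP[/eqP-> h] ->.
- by move=> h; exists (j, i); rewrite // mem_filter eqxx.
Qed.

Lemma matchstick_ok_exists n F : realizable F -> matchstick_ok n F ->
  exists (e : rel 'I_n) (p : 'I_n -> point), matchstick_graph e p /\ four_regular e.
Proof.
case=> ps [sF nF eF] /and5P[/eqP sn /allP irr pts segs /allP deg].
have sp : size ps = n by rewrite sF.
pose E := fedges F; pose P i := nth p0 ps i.
have nearP (i : 'I_n) : near (fnth F i) (P i) by apply: nF; rewrite sp.
have inj (i j : 'I_n) : P i = P j -> i = j.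
  have lt (k l : 'I_n) : (k < l)%N -> P k <> P l.
    move=> kl e; have := elimT (pairwiseP bp0) pts k l.
    rewrite !inE sn => /(_ (ltn_ord k) (ltn_ord l) kl).
    have [k1 k2] := nearP k; have [l1 l2] := nearP l.
    by move=> /orP[] h; [apply: (apartP h k1 l1) | apply: (apartP h k2 l2)]; rewrite e.
  move=> e; apply: val_inj; case: (ltngtP i j) => // h; [case: (lt i j h)|case: (lt j i h)] => //.
exists (fun i j : 'I_n => (j : nat) \in nbrs E i), (fun i : 'I_n => P i).
have unit (i j : 'I_n) : (j : nat) \in nbrs E i -> sqdist (P i) (P j) = 1.
  by rewrite mem_nbrs => /orP[] /eF[_ _] //=; rewrite sqdistC.
have ne (i j : 'I_n) : (j : nat) \in nbrs E i -> i != j.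
  rewrite mem_nbrs => h; apply/eqP => e; move: h; rewrite e orbb => /irr; by rewrite eqxx.
split; last first.
  move=> i; have := deg i; rewrite mem_iota ltn_ord => /(_ isT) /eqP <-.
  rewrite cardE -(size_map (@nat_of_ord n)); apply: perm_size; apply: uniq_perm.
  - by rewrite map_inj_uniq ?enum_uniq //; apply: ord_inj.
  - exact: undup_uniq.
  move=> j; rewrite mem_undup; apply/mapP/idP.
    by case=> k; rewrite mem_enum inE => h ->.
  (* Listed neighbours are vertices, because realized edges have both ends among the points. *)
  move=> h; have jn : (j < n)%N.
    by move: (h); rewrite mem_nbrs sp in eF * => /orP[] /eF[].
  by exists (Ordinal jn); rewrite // mem_enum inE.
split; first by move=> i; apply/negP => /ne; rewrite eqxx.
split; first by move=> i j; rewrite !mem_nbrs orbC.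
split; first by move=> i j; apply: inj.
split; first exact: unit.
move=> i j k l ij kl ne_set q hq1 hq2.
have share (a b c : 'I_n) : (b : nat) \in nbrs E a -> (c : nat) \in nbrs E a -> [set a; b] != [set a; c] ->
    on_segment (P a) (P b) q -> on_segment (P a) (P c) q -> q = P a.
  move=> ab ac nes h1 h2; apply: (unit_segments_meet (unit _ _ ab) (unit _ _ ac) _ h1 h2) => e.
  by move: nes; rewrite (inj _ _ e) eqxx.
have sym (a b : 'I_n) : (b : nat) \in nbrs E a -> (a : nat) \in nbrs E b by rewrite !mem_nbrs orbC.
(* If the edges have a common end, both are turned so that it comes first, and [share] applies. Four
   disequalities remain otherwise. *)
case: (eqVneq i k) => [ik|nik].
  subst k; exists i; first by rewrite !inE eqxx.
  exact: share ij kl ne_set hq1 hq2.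
case: (eqVneq i l) => [il|nxl].
  subst l; exists i; first by rewrite !inE eqxx orbT.
  apply: (share i j k ij (sym _ _ kl)) => //; last exact: on_segmentC.
  by rewrite [X in _ != X]setUC.
case: (eqVneq j k) => [jk|njk].
  subst k; exists j; first by rewrite !inE eqxx orbT.
  apply: (share j i l (sym _ _ ij) kl) => //; last exact: on_segmentC.
  by rewrite setUC.
case: (eqVneq j l) => [jl|njl].
  subst l; exists j; first by rewrite !inE eqxx !orbT.
  apply: (share j i k (sym _ _ ij) (sym _ _ kl)) => //; try exact: on_segmentC.
  by rewrite setUC [X in _ != X]setUC.
exfalso.
pose G e := let s : segment := (fnth F e.1, fnth F e.2) in (e : nat * nat, (s, box s)).
have far (a b c d : 'I_n) : ((a : nat), (b : nat)) \in E -> ((c : nat), (d : nat)) \in E ->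
   a != c -> a != d -> b != c -> b != d ->
   on_segment (P a) (P b) q -> on_segment (P c) (P d) q -> False.
  (* The check compares an edge with later ones only, so the two edges are ordered by their position
     in the list. *)
  have lt (a' b' c' d' : 'I_n) : ((a' : nat), (b' : nat)) \in E -> ((c' : nat), (d' : nat)) \in E ->
     (index ((a' : nat), (b' : nat)) E < index ((c' : nat), (d' : nat)) E)%N ->
     a' != c' -> a' != d' -> b' != c' -> b' != d' ->
     on_segment (P a') (P b') q -> on_segment (P c') (P d') q -> False.
    move=> h1 h2 hlt n1 n2 n3 n4 o1 o2.
    have := fun h1 h2 => elimT (pairwiseP (G (0, 0)%N)) segs _ _ h1 h2 hlt.
    rewrite !inE size_map !index_mem => /(_ h1 h2).
    rewrite !(nth_map (0, 0)%N) ?index_mem // !nth_index // {}/G.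
    have -> : meet (a' : nat, b' : nat) (c' : nat, d' : nat) = false.
      by rewrite /meet !val_eqE (negbTE n1) (negbTE n2) (negbTE n3) (negbTE n4).
    case: ifP => [apt _|_ sepd].
      exact: (boxes_apartP apt (nearP a') (nearP b') (nearP c') (nearP d') o1 o2).
    exact: (separatedP sepd (nearP a') (nearP b') (nearP c') (nearP d') o1 o2).
  move=> h1 h2 n1 n2 n3 n4 o1 o2.
  case: (ltngtP (index ((a : nat), (b : nat)) E) (index ((c : nat), (d : nat)) E)) => h.
  - exact: (lt a b c d).
  - by apply: (lt c d a b) => //; rewrite eq_sym.
  - have := congr1 (nth (0, 0)%N E) h; rewrite !nth_index // => -[e _].
    by move: n1; rewrite (val_inj e) eqxx.
move: ij kl; rewrite !mem_nbrs => /orP[] h1 /orP[] h2.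
- exact: (far i j k l).
- by apply: (far i j l k) => //; apply: on_segmentC.
- by apply: (far j i k l) => //; apply: on_segmentC.
- by apply: (far j i l k) => //; apply: on_segmentC.
Qed.

Transparent bmul.

(** * Certified pieces with one mirror line *)

Definition newton (es : seq (nat * nat)) zA : fig := newton_fig zA.1 es zA.2 1000.
(** One choice of bounds fits all figures: the parameters stay below about [10 ^ -9], the defect of
    the inverse below [10 ^ -4], and the 1-norms of row differences along edges below [100], in real
    units. *)
Definition newton_check (es : seq (nat * nat)) zA :=
  newton_ok zA.1 es zA.2 1000 (10 ^ 17) (10 ^ 11) (10 ^ 13).

Lemma newton_check_realizable es zA : newton_check es zA -> realizable (newton es zA).
Proof. exact: newton_realizable. Qed.

(** [F] enters through an equation, so that figures can be stored evaluated and the equation be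
    settled by computation. *)
Lemma mirrored_realizable es zA ks F :
  newton_check es zA && mirrorX_ok (newton es zA) ks -> F = mirrorX (newton es zA) ks ->
  realizable F.
Proof. by case/andP=> /newton_check_realizable h ok ->; apply: mirrorX_realizable. Qed.

Lemma doubly_mirrored_realizable es zA ks ks' F :
  [&& newton_check es zA, mirrorX_ok (newton es zA) ks &
      mirrorY_ok (mirrorX (newton es zA) ks) ks'] ->
  F = mirrorY (mirrorX (newton es zA) ks) ks' -> realizable F.
Proof.
case/and3P=> /newton_check_realizable h ok ok' ->.
by apply: mirrorY_realizable => //; apply: mirrorX_realizable.
Qed.

(* Approximate coordinates are given in units of [10 ^ -6]. *)
Definition data21 : seq (Z * Z) := [::
    (2495997, 2936682); (840171, 1814969); (2639516, 941838); (1739843, 1378403);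
    (1668084, 2375825); (2567757, 1939260); (0, 0); (1991895, 179875); (420086, 907485);
    (1416033, 997422); (995947, 89937); (2975584, 0)]%Z.
Definition bars21 : seq (nat * nat) := [::
    (1, 3); (2, 3); (1, 4); (0, 4); (2, 5); (0, 5); (3, 4); (4, 5); (3, 5); (1, 8); (6, 8);
    (1, 9); (7, 9); (6, 10); (7, 10); (8, 9); (9, 10); (8, 10); (2, 7); (7, 11); (2, 11)]%N.
Definition approx21 := Eval vm_compute in refine data21 bars21.
(** The listed vertices lie on the mirror line. Vertex [0], of degree 2, does not; its reflection,
    the other tip, is therefore the first vertex appended to the half. The other pieces follow the
    same convention. *)
Definition piece21 : fig := Eval vm_compute in mirrorX (newton bars21 approx21) [:: 6; 11]%N.
Lemma piece21_realizable : realizable piece21.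
Proof. by apply: (@mirrored_realizable bars21 approx21 [:: 6; 11]%N); vm_compute. Qed.

Definition data29 : seq (Z * Z) := [::
    (2426492, 3948470); (2467077, 1948882); (715090, 2913528); (1591084, 2431205);
    (2446785, 2948676); (1570791, 3430999); (1735509, 1267113); (2691722, 974441);
    (1960154, 292672); (2916366, 0); (0, 0); (960245, 279159); (238363, 971176);
    (1198608, 1250335); (476727, 1942352); (1436972, 2221511)]%Z.
Definition bars29 : seq (nat * nat) := [::
    (1, 3); (2, 3); (1, 4); (0, 4); (2, 5); (0, 5); (3, 4); (4, 5); (3, 5); (1, 6); (6, 7);
    (7, 8); (8, 9); (1, 7); (6, 8); (7, 9); (10, 11); (11, 12); (12, 13); (13, 14);
    (14, 15); (2, 15); (10, 12); (11, 13); (12, 14); (13, 15); (2, 14); (8, 11); (6, 15)]%N.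
Definition approx29 := Eval vm_compute in refine data29 bars29.
Definition piece29 : fig := Eval vm_compute in mirrorX (newton bars29 approx29) [:: 10; 9]%N.
Lemma piece29_realizable : realizable piece29.
Proof. by apply: (@mirrored_realizable bars29 approx29 [:: 10; 9]%N); vm_compute. Qed.

Definition data30 : seq (Z * Z) := [::
    (-3007945, 3845604); (0, 0); (-999326, 36705); (-467876, 883794); (-1467202, 920499);
    (-935752, 1767588); (-1935078, 1804293); (-1403628, 2651382); (-3240013, 1859114);
    (-2619333, 1075050); (-3608692, 929557); (-2988012, 145493); (-3977371, 0);
    (-3123979, 2852359); (-2205787, 3248493); (-2321820, 2255248); (-1998652, 0)]%Z.
Definition bars30 : seq (nat * nat) := [::
    (1, 2); (2, 3); (3, 4); (4, 5); (5, 6); (6, 7); (1, 3); (2, 4); (3, 5); (4, 6); (5, 7);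
    (8, 9); (9, 10); (10, 11); (11, 12); (8, 10); (9, 11); (10, 12); (0, 13); (8, 13);
    (0, 14); (7, 14); (8, 15); (7, 15); (13, 14); (14, 15); (13, 15); (6, 9); (2, 16);
    (11, 16)]%N.
Definition approx30 := Eval vm_compute in refine data30 bars30.
Definition piece30 : fig := Eval vm_compute in mirrorX (newton bars30 approx30) [:: 1; 12; 16]%N.
Lemma piece30_realizable : realizable piece30.
Proof. by apply: (@mirrored_realizable bars30 approx30 [:: 1; 12; 16]%N); vm_compute. Qed.

Definition data33 : seq (Z * Z) := [::
    (250000, 4432347); (1000000, 1732051); (-713525, 700629); (-750000, 2700297);
    (143237, 1216340); (125000, 2216174); (-731763, 1700463); (250000, 968246);
    (1963525, 1999667); (2000000, 0); (1106763, 1483957); (1125000, 484123);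
    (1981763, 999834); (1250000, 2700297); (-250000, 3566322); (250000, 2700297);
    (750000, 3566322); (0, 0)]%Z.
Definition bars33 : seq (nat * nat) := [::
    (1, 4); (2, 4); (1, 5); (3, 5); (2, 6); (3, 6); (4, 5); (5, 6); (4, 6); (7, 10);
    (8, 10); (7, 11); (9, 11); (8, 12); (9, 12); (10, 11); (11, 12); (10, 12); (3, 14);
    (0, 14); (3, 15); (13, 15); (0, 16); (13, 16); (14, 15); (15, 16); (14, 16); (8, 13);
    (1, 8); (1, 13); (2, 7); (7, 17); (2, 17)]%N.
Definition approx33 := Eval vm_compute in refine data33 bars33.
Definition piece33 : fig := Eval vm_compute in mirrorX (newton bars33 approx33) [:: 17; 9]%N.
Lemma piece33_realizable : realizable piece33.
Proof. by apply: (@mirrored_realizable bars33 approx33 [:: 17; 9]%N); vm_compute. Qed.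

Definition data34 : seq (Z * Z) := [::
    (74036, 4368242); (0, 0); (-790569, 612372); (135045, 990839); (-879858, 2610378);
    (895110, 1688701); (7626, 2149540); (-835214, 1611375); (52270, 1150537);
    (1119444, 2663214); (-402911, 3489310); (119793, 2636796); (596740, 3515728);
    (1851230, 1981679); (1060660, 1369306); (1986275, 990839); (1195706, 378467);
    (2121320, 0); (270091, 0)]%Z.
Definition bars34 : seq (nat * nat) := [::
    (1, 2); (2, 3); (1, 3); (4, 6); (5, 6); (4, 7); (2, 7); (5, 8); (2, 8); (6, 7); (7, 8);
    (6, 8); (4, 10); (0, 10); (4, 11); (9, 11); (0, 12); (9, 12); (10, 11); (11, 12);
    (10, 12); (5, 9); (9, 13); (5, 13); (13, 14); (14, 15); (15, 16); (16, 17); (13, 15);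
    (14, 16); (15, 17); (3, 18); (16, 18); (3, 14)]%N.
Definition approx34 := Eval vm_compute in refine data34 bars34.
Definition piece34 : fig := Eval vm_compute in mirrorX (newton bars34 approx34) [:: 1; 17; 18]%N.
Lemma piece34_realizable : realizable piece34.
Proof. by apply: (@mirrored_realizable bars34 approx34 [:: 1; 17; 18]%N); vm_compute. Qed.

Definition data35 : seq (Z * Z) := [::
    (1010173, 3870213); (3923050, 0); (3256288, 1885584); (1956705, 365359);
    (3589669, 942792); (2939877, 182680); (2606496, 1125472); (1383177, 1184545);
    (960505, 278263); (0, 0); (239270, 970953); (1547896, 2170886); (2319732, 1535065);
    (2484451, 2521405); (1718633, 3164463); (753205, 2903793); (1461666, 2198043);
    (496238, 1937373); (1204698, 1231623)]%Z.
Definition bars35 : seq (nat * nat) := [::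
    (1, 4); (2, 4); (1, 5); (3, 5); (2, 6); (3, 6); (4, 5); (5, 6); (4, 6); (3, 7); (7, 8);
    (3, 8); (8, 9); (8, 10); (9, 10); (7, 11); (11, 12); (12, 13); (2, 13); (7, 12);
    (11, 13); (2, 12); (0, 14); (14, 15); (15, 16); (16, 17); (17, 18); (10, 18); (0, 15);
    (14, 16); (15, 17); (16, 18); (10, 17); (13, 14); (11, 18)]%N.
Definition approx35 := Eval vm_compute in refine data35 bars35.
Definition piece35 : fig := Eval vm_compute in mirrorX (newton bars35 approx35) [:: 9; 1]%N.
Lemma piece35_realizable : realizable piece35.
Proof. by apply: (@mirrored_realizable bars35 approx35 [:: 9; 1]%N); vm_compute. Qed.

Definition data36 : seq (Z * Z) := [::
    (1656374, 4545637); (2778064, 2889795); (1102041, 1798490); (2885150, 892664);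
    (1940052, 2344142); (2831607, 1891229); (1993596, 1345577); (783218, 2746304);
    (2217219, 3717716); (1780641, 2818049); (1219796, 3645970); (121798, 1996288);
    (2337443, 55994); (3335874, 0); (1789735, 892664); (1339012, 0); (0, 0);
    (955767, 1444476); (894868, 446332); (60899, 998144)]%Z.
Definition bars36 : seq (nat * nat) := [::
    (1, 4); (2, 4); (1, 5); (3, 5); (2, 6); (3, 6); (4, 5); (5, 6); (4, 6); (1, 8); (0, 8);
    (1, 9); (7, 9); (0, 10); (7, 10); (8, 9); (9, 10); (8, 10); (2, 7); (7, 11); (2, 11);
    (3, 12); (12, 13); (3, 13); (12, 14); (14, 15); (12, 15); (14, 17); (11, 17); (14, 18);
    (16, 18); (11, 19); (16, 19); (17, 18); (18, 19); (17, 19)]%N.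
Definition approx36 := Eval vm_compute in refine data36 bars36.
Definition piece36 : fig := Eval vm_compute in mirrorX (newton bars36 approx36) [:: 16; 15; 13]%N.
Lemma piece36_realizable : realizable piece36.
Proof. by apply: (@mirrored_realizable bars36 approx36 [:: 16; 15; 13]%N); vm_compute. Qed.

(** * Closed graphs with two perpendicular mirror lines *)

Definition data66 : seq (Z * Z) := [::
    (850583, 700629); (1657054, 1291903); (741761, 1694690); (1814109, 968246);
    (1564109, 0); (1979402, 3265755); (3527634, 1999667); (1818228, 2278829);
    (2753518, 2632711); (2592344, 1645785); (0, 3552052); (370880, 2623371);
    (989701, 3408903); (1360582, 2480223); (3564109, 0); (3545872, 999834);
    (2689109, 484123); (2670872, 1483957)]%Z.
Definition bars66 : seq (nat * nat) := [::
    (0, 1); (1, 2); (0, 2); (0, 3); (0, 4); (3, 4); (5, 7); (1, 7); (5, 8); (6, 8); (1, 9);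
    (6, 9); (7, 8); (8, 9); (7, 9); (10, 11); (2, 11); (10, 12); (5, 12); (2, 13); (5, 13);
    (11, 12); (12, 13); (11, 13); (14, 15); (6, 15); (14, 16); (3, 16); (6, 17); (3, 17);
    (15, 16); (16, 17); (15, 17)]%N.
Definition approx66 := Eval vm_compute in refine data66 bars66.
(** The second list counts vertices of the half: [27] is the reflection of vertex [10], and both lie
    on the vertical axis. *)
Definition closed66 : fig := Eval vm_compute in
  mirrorY (mirrorX (newton bars66 approx66) [:: 4; 14]%N) [:: 10; 27]%N.
Lemma closed66_realizable : realizable closed66.
Proof.
by apply: (@doubly_mirrored_realizable bars66 approx66 [:: 4; 14]%N [:: 10; 27]%N); vm_compute.
Qed.

Definition data68 : seq (Z * Z) := [::
    (1412643, 0); (1716682, 952660); (739635, 739635); (2020720, 0); (2576995, 963497);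
    (2135467, 1860745); (3133271, 1794495); (2691743, 2691743); (3574798, 897248);
    (3018523, 66250); (4016326, 0); (0, 1412643); (952660, 1716682); (0, 2020720);
    (963497, 2576995); (1860745, 2135467); (1794495, 3133271); (897248, 3574798);
    (66250, 3018523); (0, 4016326)]%Z.
Definition bars68 : seq (nat * nat) := [::
    (0, 1); (1, 2); (0, 2); (4, 5); (5, 6); (6, 7); (4, 6); (5, 7); (4, 8); (8, 9);
    (9, 10); (4, 9); (8, 10); (6, 8); (3, 9); (1, 5); (1, 3); (11, 12); (2, 12); (2, 11);
    (14, 15); (15, 16); (7, 16); (14, 16); (7, 15); (14, 17); (17, 18); (18, 19); (14, 18);
    (17, 19); (16, 17); (13, 18); (12, 15); (12, 13)]%N.
Definition approx68 := Eval vm_compute in refine data68 bars68.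
Definition closed68 : fig := Eval vm_compute in
  mirrorY (mirrorX (newton bars68 approx68) [:: 0; 3; 10]%N) [:: 11; 13; 19; 28; 30; 36]%N.
Lemma closed68_realizable : realizable closed68.
Proof.
by apply: (@doubly_mirrored_realizable bars68 approx68 [:: 0; 3; 10]%N [:: 11; 13; 19; 28; 30; 36]%N); vm_compute.
Qed.

Definition data82 : seq (Z * Z) := [::
    (2830177, 3793095); (2071239, 3141933); (1886785, 4124774); (1127846, 3473612);
    (943392, 4456453); (184454, 3805290); (0, 4788132); (0, 3259911); (999417, 3225778);
    (470148, 2377324); (1469566, 2343190); (940297, 1494736); (3698453, 1991402);
    (1881225, 1156129); (3513207, 0); (2789839, 1573766); (3605830, 995701);
    (2697216, 578065); (1704003, 2140300); (3264315, 2892249); (2701228, 2065851);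
    (2267090, 2966698)]%Z.
Definition bars82 : seq (nat * nat) := [::
    (0, 1); (1, 2); (2, 3); (3, 4); (4, 5); (5, 6); (0, 2); (1, 3); (2, 4); (3, 5); (4, 6);
    (7, 8); (8, 9); (9, 10); (10, 11); (7, 9); (8, 10); (9, 11); (12, 15); (13, 15);
    (12, 16); (14, 16); (13, 17); (14, 17); (15, 16); (16, 17); (15, 17); (12, 19);
    (0, 19); (12, 20); (18, 20); (0, 21); (18, 21); (19, 20); (20, 21); (19, 21); (13, 18);
    (11, 18); (11, 13); (5, 8); (1, 10)]%N.
Definition approx82 := Eval vm_compute in refine data82 bars82.
Definition closed82 : fig := Eval vm_compute in
  mirrorY (mirrorX (newton bars82 approx82) [:: 14]%N) [:: 6; 7; 28; 29]%N.
Lemma closed82_realizable : realizable closed82.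
Proof.
by apply: (@doubly_mirrored_realizable bars82 approx82 [:: 14]%N [:: 6; 7; 28; 29]%N); vm_compute.
Qed.

Definition data70 : seq (Z * Z) := [::
    (2775012, 2777510); (1983457, 2166412); (1850008, 3157468); (1058453, 2546370);
    (925004, 3537426); (133449, 2926328); (0, 3917383); (3908783, 0); (2918023, 135627);
    (3530859, 925837); (2540099, 1061464); (3152935, 1851673); (2162175, 1987300);
    (985264, 2106310); (1492596, 1244560); (492632, 1236073); (999964, 374322);
    (0, 365835); (1927263, 0); (0, 1935272)]%Z.
Definition bars70 : seq (nat * nat) := [::
    (0, 1); (1, 2); (2, 3); (3, 4); (4, 5); (5, 6); (0, 2); (1, 3); (2, 4); (3, 5); (4, 6);
    (7, 8); (8, 9); (9, 10); (10, 11); (11, 12); (0, 12); (7, 9); (8, 10); (9, 11);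
    (10, 12); (0, 11); (13, 14); (14, 15); (15, 16); (16, 17); (13, 15); (14, 16);
    (15, 17); (8, 18); (16, 18); (12, 14); (5, 19); (1, 13); (13, 19)]%N.
Definition approx70 := Eval vm_compute in refine data70 bars70.
Definition closed70 : fig := Eval vm_compute in
  mirrorY (mirrorX (newton bars70 approx70) [:: 18; 7]%N) [:: 6; 19; 17; 26; 37; 36]%N.
Lemma closed70_realizable : realizable closed70.
Proof.
by apply: (@doubly_mirrored_realizable bars70 approx70 [:: 18; 7]%N [:: 6; 19; 17; 26; 37; 36]%N); vm_compute.
Qed.

(** * The rings for all other orders, and the theorem *)

(* [piece a] has [a + 1] vertices, of which [0] is a tip; the other tip is returned along
   with it. A ring of pieces has as many vertices as the [a]'s sum up to. *)
Definition piece (a : nat) : fig * nat :=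
  (if a == 21 then (piece21, 12)
   else if a == 29 then (piece29, 16)
   else if a == 30 then (piece30, 17)
   else if a == 33 then (piece33, 18)
   else if a == 34 then (piece34, 19)
   else if a == 35 then (piece35, 19)
   else (piece36, 20))%N.

Lemma piece_realizable a : realizable (piece a).1.
Proof.
rewrite /piece; repeat case: ifP => _.
- exact: piece21_realizable.
- exact: piece29_realizable.
- exact: piece30_realizable.
- exact: piece33_realizable.
- exact: piece34_realizable.
- exact: piece35_realizable.
- exact: piece36_realizable.
Qed.

(** Exchanging the tips gives the piece a half turn about the midpoint of its side, which swaps what
    lies inside the polygon with what lies outside. *)
Definition to_link (l : nat * bool) : link :=
  let: (F, t) := piece l.1 in if l.2 then (F, t, 0%N) else (F, 0%N, t).

(* Number of vertices, pieces (with their orientation) and diagonals in thousandths. *)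
Definition rings : seq (nat * (seq (nat * bool) * seq Z)) := [::
  (63, ([:: (21, false); (21, false); (21, false)], [::]%Z));
  (71, ([:: (21, false); (21, false); (29, false)], [::]%Z));
  (72, ([:: (21, false); (21, false); (30, true)], [::]%Z));
  (75, ([:: (21, false); (21, false); (33, true)], [::]%Z));
  (76, ([:: (21, false); (21, false); (34, true)], [::]%Z));
  (77, ([:: (21, false); (21, false); (35, true)], [::]%Z));
  (78, ([:: (21, false); (21, false); (36, false)], [::]%Z));
  (79, ([:: (21, false); (29, false); (29, false)], [::]%Z));
  (80, ([:: (21, false); (29, false); (30, true)], [::]%Z));
  (81, ([:: (21, false); (30, true); (30, true)], [::]%Z));
  (83, ([:: (21, false); (29, false); (33, true)], [::]%Z));
  (84, ([:: (21, false); (29, false); (34, true)], [::]%Z));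
  (85, ([:: (21, false); (29, false); (35, true)], [::]%Z));
  (86, ([:: (21, false); (29, false); (36, false)], [::]%Z));
  (87, ([:: (29, false); (29, false); (29, false)], [::]%Z));
  (88, ([:: (29, false); (29, false); (30, false)], [::]%Z));
  (89, ([:: (29, false); (30, true); (30, true)], [::]%Z));
  (90, ([:: (30, true); (30, true); (30, true)], [::]%Z));
  (91, ([:: (21, false); (35, true); (35, true)], [::]%Z));
  (92, ([:: (29, false); (29, false); (34, false)], [::]%Z));
  (93, ([:: (29, false); (29, false); (35, false)], [::]%Z));
  (94, ([:: (29, false); (29, false); (36, false)], [::]%Z));
  (95, ([:: (29, false); (30, true); (36, false)], [::]%Z));
  (96, ([:: (30, true); (30, true); (36, false)], [::]%Z));
  (97, ([:: (29, false); (33, false); (35, true)], [::]%Z));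
  (98, ([:: (29, false); (34, false); (35, true)], [::]%Z));
  (99, ([:: (29, false); (35, true); (35, true)], [::]%Z));
  (100, ([:: (29, false); (35, true); (36, false)], [::]%Z));
  (101, ([:: (30, true); (35, true); (36, false)], [::]%Z));
  (102, ([:: (33, true); (33, true); (36, true)], [::]%Z));
  (103, ([:: (33, true); (34, true); (36, true)], [::]%Z));
  (104, ([:: (34, false); (35, true); (35, true)], [::]%Z));
  (105, ([:: (35, true); (35, true); (35, true)], [::]%Z));
  (106, ([:: (35, true); (35, true); (36, false)], [::]%Z));
  (107, ([:: (21, false); (29, false); (36, false); (21, false)], [:: 10310]%Z));
  (108, ([:: (21, false); (30, true); (36, false); (21, false)], [:: 10219]%Z));
  (109, ([:: (21, false); (34, false); (33, true); (21, false)], [:: 10580]%Z));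
  (110, ([:: (21, false); (21, false); (35, true); (33, false)], [:: 9604]%Z));
  (111, ([:: (21, false); (33, true); (36, true); (21, false)], [:: 10728]%Z));
  (112, ([:: (21, false); (34, true); (36, false); (21, false)], [:: 10673]%Z));
  (113, ([:: (21, false); (21, false); (36, false); (35, true)], [:: 9654]%Z));
  (114, ([:: (21, false); (21, false); (36, false); (36, true)], [:: 9867]%Z));
  (115, ([:: (21, false); (29, false); (29, false); (36, false)], [:: 10759]%Z));
  (116, ([:: (21, false); (36, false); (29, false); (30, false)], [:: 10917]%Z));
  (117, ([:: (21, false); (33, false); (34, false); (29, false)], [:: 11140]%Z));
  (118, ([:: (21, false); (35, false); (33, true); (29, false)], [:: 10618]%Z));
  (119, ([:: (21, false); (33, false); (36, false); (29, false)], [:: 11247]%Z));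
  (120, ([:: (21, false); (29, false); (36, false); (34, false)], [:: 10943]%Z))]%N.

Definition ring_of (r : seq (nat * bool) * seq Z) : seq link * seq Z :=
  ([seq to_link l | l <- r.1], [seq (d * unitZ / 1000)%Z | d <- r.2]).

Lemma rings_ok :
  all (fun r => let: (ys, ds) := ring_of r.2 in
         ring_ok ys ds && matchstick_ok r.1 (ring ys ds)) rings.
Proof. by vm_compute. Qed.

Lemma in_rings n : n \in unzip1 rings ->
  exists (e : rel 'I_n) (p : 'I_n -> point), matchstick_graph e p /\ four_regular e.
Proof.
case/(nthP 0%N)=> i; rewrite size_map => hi <-.
rewrite (nth_map (0%N, ([::], [::]))) //; set r := nth _ _ i.
have /andP[ok] := elimT (all_nthP (0%N, ([::], [::]))) rings_ok i hi; rewrite -/r.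
apply: matchstick_ok_exists; apply: ring_realizable => //.
apply/List.Forall_forall => y /List.in_map_iff[[a b] [<- _]].
by rewrite /to_link /=; case: (piece a) (piece_realizable a) => F t /= h; case: b.
Qed.

Close Scope R_scope.

Theorem theorem4p1 (n : nat) :
  62 < n < 121 -> n \notin [:: 64; 65; 67; 69; 73; 74] ->
  exists (e : rel 'I_n) (p : 'I_n -> point),
    matchstick_graph e p /\ four_regular e.
Proof.
move=> /andP[n1 n2] hx.
(* The [58] orders from [63] to [120] are checked by evaluation: each admissible one is that of a
   ring or of one of the four doubly symmetric graphs. *)
have covered : all (fun k => (k \notin [:: 64; 65; 67; 69; 73; 74]) ==>
    (k \in [:: 66; 68; 82; 70] ++ unzip1 rings)) (iota 63 58) by vm_compute.
have : n \in [:: 66; 68; 82; 70] ++ unzip1 rings.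
  by apply: (implyP (allP covered n _) hx); rewrite mem_iota n1.
rewrite mem_cat => /orP[|]; last exact: in_rings.
rewrite !inE => /or4P[] /eqP->.
- by apply: (matchstick_ok_exists closed66_realizable); vm_compute.
- by apply: (matchstick_ok_exists closed68_realizable); vm_compute.
- by apply: (matchstick_ok_exists closed82_realizable); vm_compute.
- by apply: (matchstick_ok_exists closed70_realizable); vm_compute.
Qed.
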